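(* Let $k$ be a field of characteristic $0$, $A$ a commutative $k$-algebra, and $X$ a cosimplicial $A$-module. Suppose that either $A$ is noetherian or $X$ is finite dimensional. If all $X^i$ are flat $A$-modules, then all $\Omega^n(X)$ are flat $A$-modules.
   Context: A cosimplicial $A$-module $X$ is finite dimensional if its normalization $N^i(X)=\{x\in X^i\mid\sigma^j(x)=0\text{ for all codegeneracies }\sigma^j\}$ vanishes for all sufficiently large $i$. Thom–Sullivan functor: $\Omega_p=k[t_0,\dots,t_p,dt_0,\dots,dt_p]/(\sum t_i-1,\sum dt_i)$ is the commutative dg algebra of polynomial differential forms on the $p$-simplex, simplicial in $p$. For a cosimplicial $A$-module $X$, $\Omega^n(X)$ is the $A$-module of all families $\{x_p\in\Omega^n_p\otimes_kX^p\}_{p\ge0}$ with $(\alpha^*\otimes1)(x_q)=(1\otimes\alpha_* )(x_p)$ in $\Omega_p^n\otimes_kX^q$ for every nondecreasing $\alpha:[p]\to[q]$. *)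

(* Defs.v *)
From HB Require Import structures.
From mathcomp Require Import all_boot all_order all_algebra.
From mathcomp Require Import generic_quotient ring_quotient.
From mathcomp Require Import finmap boolp zify.
From mathcomp.multinomials Require Import monalg.

Set Implicit Arguments.
Unset Strict Implicit.
Unset Printing Implicit Defensive.

Import GRing.Theory.
Import Quotient.

Local Open Scope ring_scope.
Local Open Scope quotient_scope.

Section Subgroup.
Variable V : zmodType.

Inductive subgroup_gen (G : V -> Prop) : V -> Prop :=
| subgroup_in x of G x : subgroup_gen G x
| subgroup_0 : subgroup_gen G 0
| subgroup_B x y of subgroup_gen G x & subgroup_gen G y :
    subgroup_gen G (x - y).

Definition subgroup_pred G : {pred V} := fun x => `[< subgroup_gen G x >].

Lemma subgroup_predP G x : reflect (subgroup_gen G x) (x \in subgroup_pred G).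
Proof. exact: asboolP. Qed.

Fact subgroup_closed G : zmod_closed (subgroup_pred G).
Proof.
split; first by apply/subgroup_predP; exact: subgroup_0.
by move=> x y /subgroup_predP hx /subgroup_predP hy; apply/subgroup_predP; exact: subgroup_B.
Qed.

HB.instance Definition _ G :=
  GRing.isZmodClosed.Build V (subgroup_pred G) (subgroup_closed G).
End Subgroup.

Section Ideal.
Variable R : pzRingType.

Inductive ideal_gen (G : R -> Prop) : R -> Prop :=
| ideal_in x of G x : ideal_gen G x
| ideal_0 : ideal_gen G 0
| ideal_B x y of ideal_gen G x & ideal_gen G y : ideal_gen G (x - y)
| ideal_M a b x of ideal_gen G x : ideal_gen G (a * x * b).

Definition ideal_pred G : {pred R} := fun x => `[< ideal_gen G x >].

Lemma ideal_predP G x : reflect (ideal_gen G x) (x \in ideal_pred G).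
Proof. exact: asboolP. Qed.

Fact ideal_closed G : zmod_closed (ideal_pred G).
Proof.
split; first by apply/ideal_predP; exact: ideal_0.
by move=> x y /ideal_predP hx /ideal_predP hy; apply/ideal_predP; exact: ideal_B.
Qed.

HB.instance Definition _ G :=
  GRing.isZmodClosed.Build R (ideal_pred G) (ideal_closed G).
End Ideal.

(* Stated for abstract R, since products in {malg _[_]} make the unifier diverge *)
Section IdealFacts.
Variables (R S : pzRingType) (f : {rmorphism R -> S}) (G : S -> Prop).
Variables (J : Type) (r : seq J) (P Q : pred J) (u v : J -> S) (x y : R).
Local Notation I := (ideal_pred G).

Lemma ideal_commutator :
  (forall i j, G (u i * v j - v j * u i)) ->
  f x = \sum_(i <- r | P i) u i -> f y = \sum_(i <- r | Q i) v i ->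
  f (x * y - y * x) \in I.
Proof.
move=> huv fx fy; rewrite rmorphB !rmorphM fx fy.
rewrite mulr_suml mulr_sumr -sumrB rpred_sum // => i _.
rewrite mulr_sumr mulr_suml -sumrB rpred_sum // => j _.
exact/ideal_predP/ideal_in.
Qed.

Lemma ideal_anticommutator :
  (forall i j, G (u i * v j + v j * u i)) ->
  f x = \sum_(i <- r | P i) u i -> f y = \sum_(i <- r | Q i) v i ->
  f (x * y + y * x) \in I.
Proof.
move=> huv fx fy; rewrite rmorphD !rmorphM fx fy.
rewrite mulr_suml mulr_sumr -big_split rpred_sum //= => i _.
rewrite mulr_sumr mulr_suml -big_split rpred_sum //= => j _.
exact/ideal_predP/ideal_in.
Qed.

Lemma ideal_square :
  (forall i j, G (u i * u j + u j * u i)) -> (forall i, G (u i * u i)) ->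
  f x = \sum_(i <- r | P i) u i -> f (x * x) \in I.
Proof.
move=> huv hu2 fx; rewrite rmorphM fx; elim: r => [|j s IHs].
  by rewrite big_nil mul0r rpred0.
rewrite big_cons; case: ifP => // _.
rewrite mulrDl !mulrDr addrA -[X in X + _]addrA.
apply: rpredD => //; apply: rpredD; first exact/ideal_predP/ideal_in.
rewrite mulr_sumr mulr_suml -big_split rpred_sum //= => i _.
exact/ideal_predP/ideal_in.
Qed.
End IdealFacts.

Section QuotFacts.
Variables (V : zmodType) (I : zmodClosed V).

Lemma quot_eqP (x y : V) :
  reflect (\pi_{quot I} x = \pi_{quot I} y) (x - y \in I).
Proof. by rewrite idealrBE; exact: eqP. Qed.

Lemma quot_eq0P (x : V) : reflect (\pi_{quot I} x = 0) (x \in I).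
Proof. by have := quot_eqP x 0; rewrite subr0 raddf0. Qed.

Lemma repr_piP (x : V) : repr (\pi_{quot I} x) - x \in I.
Proof. by apply/quot_eqP; rewrite reprK. Qed.
End QuotFacts.

(* Additive extension to the free abelian group {malg int[K]} *)
Section FreeLift.
Variables (K : choiceType) (V : zmodType) (h : K -> V).

Definition free_lift (z : {malg int[K]}) : V :=
  \sum_(p <- msupp z) h p *~ z@_p.

Lemma free_liftEw (d : {fset K}) (z : {malg int[K]}) :
  (msupp z `<=` d)%fset -> free_lift z = \sum_(p <- d) h p *~ z@_p.
Proof.
move=> sub; rewrite /free_lift; apply/big_fset_incl => // p _.
by move=> /mcoeff_outdom ->; rewrite mulr0z.
Qed.

Fact free_lift_is_zmod_morphism : zmod_morphism free_lift.
Proof.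
move=> x y; pose d := (msupp x `|` msupp y)%fset.
rewrite (@free_liftEw d x) ?fsubsetUl // (@free_liftEw d y) ?fsubsetUr //.
rewrite (@free_liftEw d (x - y)) ?msuppB_le // -sumrB.
by apply: eq_bigr => p _; rewrite mcoeffB mulrzBr.
Qed.

HB.instance Definition _ :=
  GRing.isZmodMorphism.Build {malg int[K]} V free_lift
    free_lift_is_zmod_morphism.

Lemma free_liftU p : free_lift << p >> = h p.
Proof.
by rewrite (@free_liftEw [fset p]%fset) ?msuppU_le // big_seq_fset1 mcoeffUU mulr1z.
Qed.
End FreeLift.

(* The tensor product over R of an R-module M and an S-module N regarded as an *)
(* R-module along phi : R -> S; it is an S-module through the second factor.   *)
Section TensorDef.
Variables (R : pzRingType) (S : comPzRingType) (phi : {rmorphism R -> S}).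
Variables (M : lmodType R) (N : lmodType S).

Inductive tensor_rel : {malg int[(M * N)%type]} -> Prop :=
| tensor_Dl m m' n : tensor_rel (<< (m + m', n) >> - << (m, n) >> - << (m', n) >>)
| tensor_Dr m n n' : tensor_rel (<< (m, n + n') >> - << (m, n) >> - << (m, n') >>)
| tensor_Z r m n : tensor_rel (<< (r *: m, n) >> - << (m, phi r *: n) >>).

Definition tensor := {quot (subgroup_pred tensor_rel)}.
HB.instance Definition _ := GRing.Zmodule.on tensor.
End TensorDef.

(* Locked, like t_ and dt_ below, because unifying << x >> with << y >> diverges *)
HB.lock Definition tens (R : pzRingType) (S : comPzRingType)
    (phi : {rmorphism R -> S}) (M : lmodType R) (N : lmodType S)
    (m : M) (n : N) : tensor phi M N :=
  \pi << (m, n) >>.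

Section Tensor.
Variables (R : pzRingType) (S : comPzRingType) (phi : {rmorphism R -> S}).
Variables (M : lmodType R) (N : lmodType S).
Local Notation tensor := (tensor phi M N).
Local Notation tensor_rel := (@tensor_rel R S phi M N).
Local Notation tens := (@tens R S phi M N).

Definition balanced (V : zmodType) (h : M -> N -> V) : Prop :=
  [/\ forall m m' n, h (m + m') n = h m n + h m' n,
      forall m n n', h m (n + n') = h m n + h m n' &
      forall r m n, h (r *: m) n = h m (phi r *: n)].

Lemma tens_balanced : balanced tens.
Proof.
split=> [m m' n|m n n'|r m n].
- apply/eqP; rewrite -subr_eq0 opprD addrA tens.unlock -!raddfB; apply/eqP.
  exact/quot_eq0P/subgroup_predP/subgroup_in/tensor_Dl.
- apply/eqP; rewrite -subr_eq0 opprD addrA tens.unlock -!raddfB; apply/eqP.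
  exact/quot_eq0P/subgroup_predP/subgroup_in/tensor_Dr.
- by rewrite tens.unlock; apply/quot_eqP/subgroup_predP/subgroup_in/tensor_Z.
Qed.

(* Meaningful when h is balanced, see tens_liftE *)
Definition tens_lift (V : zmodType) (h : M -> N -> V) (x : tensor) : V :=
  free_lift (fun p => h p.1 p.2) (repr x).

Lemma tens_lift_pi (V : zmodType) (h : M -> N -> V) (z : {malg int[(M * N)%type]}) :
  balanced h ->
  tens_lift h (\pi z) = free_lift (fun p => h p.1 p.2) z.
Proof.
move=> [hDl hDr hZ]; apply/eqP; rewrite -subr_eq0 -raddfB /=.
have /subgroup_predP := repr_piP (subgroup_pred tensor_rel) z.
elim=> [_ [m m' n|m n n'|r m n]||x y _ /eqP hx _ /eqP hy].
- by rewrite !raddfB /= !free_liftU /= hDl -addrA -opprD subrr.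
- by rewrite !raddfB /= !free_liftU /= hDr -addrA -opprD subrr.
- by rewrite !raddfB /= !free_liftU /= hZ subrr.
- by rewrite raddf0.
- by rewrite raddfB /= hx hy subrr.
Qed.

Lemma tens_liftE (V : zmodType) (h : M -> N -> V) m n :
  balanced h -> tens_lift h (tens m n) = h m n.
Proof. by move=> hb; rewrite tens.unlock tens_lift_pi // free_liftU. Qed.

Lemma tens_lift_zmod_morphism (V : zmodType) (h : M -> N -> V) :
  balanced h -> zmod_morphism (tens_lift h).
Proof.
move=> hb x y; rewrite -[x]reprK -[y]reprK -raddfB.
by rewrite !tens_lift_pi // raddfB.
Qed.

Lemma tens_sum (x : tensor) :
  x = \sum_(p <- msupp (repr x)) tens p.1 p.2 *~ (repr x)@_p.
Proof.
rewrite -[LHS]reprK [in LHS](monalgE (repr x)) raddf_sum /=; apply: eq_bigr => -[m n] _.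
by rewrite tens.unlock -!raddfMz /= intz.
Qed.

Lemma tens_ext (V : zmodType) (f g : tensor -> V) :
  zmod_morphism f -> zmod_morphism g ->
  (forall m n, f (tens m n) = g (tens m n)) -> f =1 g.
Proof.
move=> fB gB fg x.
pose f' : {additive tensor -> V} := HB.pack f (GRing.isZmodMorphism.Build _ _ f fB).
pose g' : {additive tensor -> V} := HB.pack g (GRing.isZmodMorphism.Build _ _ g gB).
suff: f' x = g' x by [].
rewrite (tens_sum x) !raddf_sum; apply: eq_bigr => p _.
by rewrite !raddfMz; congr (_ *~ _); exact: fg.
Qed.

Definition tens_scale (a : S) : tensor -> tensor :=
  tens_lift (fun m n => tens m (a *: n)).

Lemma tens_scale_balanced a : balanced (fun m n => tens m (a *: n)).
Proof.
have [tDl tDr tZ] := tens_balanced.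
split=> [m m' n|m n n'|r m n]; first by rewrite tDl.
  by rewrite scalerDr tDr.
by rewrite tZ !scalerA mulrC.
Qed.

Lemma tens_scaleE a m n : tens_scale a (tens m n) = tens m (a *: n).
Proof. exact/tens_liftE/tens_scale_balanced. Qed.

Fact tens_scaleB a : zmod_morphism (tens_scale a).
Proof. exact/tens_lift_zmod_morphism/tens_scale_balanced. Qed.

Fact tens_scaleA a b x : tens_scale a (tens_scale b x) = tens_scale (a * b) x.
Proof.
apply: (tens_ext (f := tens_scale a \o tens_scale b)).
- by move=> y z /=; rewrite !tens_scaleB.
- exact: tens_scaleB.
by move=> m n /=; rewrite !tens_scaleE scalerA.
Qed.

Fact tens_scale1 : left_id 1 tens_scale.
Proof.
apply: (tens_ext (g := id)); [exact: tens_scaleB | by [] |].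
by move=> m n; rewrite tens_scaleE scale1r.
Qed.

Fact tens_scaleDr : right_distributive tens_scale +%R.
Proof.
move=> a x y.
have tN z : tens_scale a (- z) = - tens_scale a z.
  have t0 : tens_scale a 0 = 0 by have := tens_scaleB a 0 0; rewrite !subrr.
  by rewrite -[- z]sub0r tens_scaleB t0 sub0r.
by rewrite -[y in LHS]opprK tens_scaleB tN opprK.
Qed.

Fact tens_scaleDl x : {morph tens_scale^~ x : a b / a + b}.
Proof.
move=> a b; apply: (tens_ext (g := fun x => tens_scale a x + tens_scale b x)).
- exact: tens_scaleB.
- by move=> y z; rewrite !tens_scaleB addrACA opprD.
move=> m n; rewrite !tens_scaleE scalerDl.
by have [_ -> _] := tens_balanced.
Qed.

HB.instance Definition _ := GRing.Zmodule_isLmodule.Build S tensor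
  tens_scaleA tens_scale1 tens_scaleDr tens_scaleDl.

Lemma scale_tens a m n : a *: tens m n = tens m (a *: n).
Proof. exact: tens_scaleE. Qed.
End Tensor.

Section TensorMap.
Variables (R : pzRingType) (S : comPzRingType) (phi : {rmorphism R -> S}).
Variables (M M' : lmodType R) (N N' : lmodType S).
Variables (f : {linear M -> M'}) (g : {linear N -> N'}).

Definition tensor_map : tensor phi M N -> tensor phi M' N' :=
  tens_lift (fun m n => tens phi (f m) (g n)).

Lemma tensor_map_balanced : balanced phi (fun m n => tens phi (f m) (g n)).
Proof.
have [tDl tDr tZ] := tens_balanced phi M' N'.
split=> [m m' n|m n n'|r m n]; first by rewrite raddfD tDl.
  by rewrite raddfD tDr.
by rewrite !linearZ tZ.
Qed.

Lemma tensor_mapE m n : tensor_map (tens phi m n) = tens phi (f m) (g n).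
Proof. exact/tens_liftE/tensor_map_balanced. Qed.

Fact tensor_map_is_zmod_morphism : zmod_morphism tensor_map.
Proof. exact/tens_lift_zmod_morphism/tensor_map_balanced. Qed.

HB.instance Definition _ :=
  GRing.isZmodMorphism.Build _ _ tensor_map tensor_map_is_zmod_morphism.

Fact tensor_map_is_scalable : scalable tensor_map.
Proof.
move=> a; apply: (tens_ext (f := tensor_map \o *:%R a)
                           (g := *:%R a \o tensor_map)).
- by move=> x y /=; rewrite scalerBr raddfB.
- by move=> x y /=; rewrite raddfB scalerBr.
by move=> m n /=; rewrite scale_tens !tensor_mapE linearZ scale_tens.
Qed.

HB.instance Definition _ :=
  GRing.isScalable.Build S _ _ *:%R tensor_map tensor_map_is_scalable.
End TensorMap.

Arguments tensor_map {R S} phi {M M' N N'} f g.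

Section CommutativeAlgebra.
Variable A : comPzRingType.

Definition exact_seq (U V W : lmodType A) (f : {linear U -> V}) (g : {linear V -> W}) :=
  forall v, g v = 0 <-> exists u, f u = v.

Definition flat (M : lmodType A) : Prop :=
  forall (U V W : lmodType A) (f : {linear U -> V}) (g : {linear V -> W}),
    exact_seq f g ->
    exact_seq
      (tensor_map (idfun : {rmorphism A -> A}) (idfun : {linear M -> M}) f)
      (tensor_map (idfun : {rmorphism A -> A}) (idfun : {linear M -> M}) g).

Definition is_ideal (I : A -> Prop) : Prop :=
  I 0 /\ forall a x y, I x -> I y -> I (a * x + y).

Definition noetherian : Prop :=
  forall I : A -> Prop, is_ideal I ->
    exists s : seq A, forall x,
      I x <-> exists c : 'I_(size s) -> A, x = \sum_(i < size s) c i * s`_i.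
End CommutativeAlgebra.

(* The nondecreasing maps [p] -> [q], where [p] = {0, ..., p} is 'I_p.+1 *)
Section Delta.

Definition nondecr p q (a : {ffun 'I_p.+1 -> 'I_q.+1}) : bool :=
  [forall i : 'I_p.+1, forall j : 'I_p.+1, (i <= j)%N ==> (a i <= a j)%N].

Definition delta p q := {a : {ffun 'I_p.+1 -> 'I_q.+1} | nondecr a}.

Definition delta_fun p q (a : delta p q) : 'I_p.+1 -> 'I_q.+1 := val a.
Coercion delta_fun : delta >-> Funclass.

Fact nondecrP p q (a : delta p q) (i j : 'I_p.+1) : (i <= j)%N -> (a i <= a j)%N.
Proof. by have /'forall_forallP/(_ i j)/implyP := valP a. Qed.

Fact nondecr_id p : nondecr [ffun i : 'I_p.+1 => i].
Proof. by apply/'forall_forallP=> i j; rewrite !ffunE implybb. Qed.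

Definition delta_id p : delta p p := Sub _ (nondecr_id p).

Fact nondecr_comp p q r (b : delta q r) (a : delta p q) :
  nondecr [ffun i => b (a i)].
Proof.
apply/'forall_forallP=> i j; apply/implyP=> leij.
by rewrite !ffunE; do 2!apply: nondecrP.
Qed.

Definition delta_comp p q r (b : delta q r) (a : delta p q) : delta p r :=
  Sub _ (nondecr_comp b a).

(* The surjection [m + 1] -> [m] that takes the value j twice *)
Fact nondecr_codegen m (j : 'I_m.+1) :
  nondecr [ffun i : 'I_m.+2 => inord (unbump j i) : 'I_m.+1].
Proof.
have lt (i : 'I_m.+2) : (unbump j i < m.+1)%N.
  have := ltn_ord i; have := ltn_ord j; rewrite /unbump; case: ltnP; lia.
apply/'forall_forallP=> i i'; apply/implyP=> leii'.
by rewrite !ffunE !inordK ?lt // /unbump; do 2!case: ltnP; lia.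
Qed.

Definition delta_codegen m (j : 'I_m.+1) : delta m.+1 m :=
  Sub _ (nondecr_codegen j).
End Delta.

Record cosimplicial (A : pzRingType) := Cosimplicial {
  cs_obj :> nat -> lmodType A;
  cs_map : forall p q, delta p q -> {linear cs_obj p -> cs_obj q};
  cs_map_id : forall p x, cs_map (delta_id p) x = x;
  cs_map_comp : forall p q r (b : delta q r) (a : delta p q) x,
    cs_map (delta_comp b a) x = cs_map b (cs_map a x)
}.

Section Normalization.
Variables (A : pzRingType) (X : cosimplicial A).

(* Membership in N^i(X) *)
Definition normalized (i : nat) : X i -> Prop :=
  match i with
  | 0 => fun _ => True
  | m.+1 => fun x => forall j : 'I_m.+1, cs_map X (delta_codegen j) x = 0
  end.

Definition finite_dimensional : Prop :=
  exists d : nat, forall i, (d <= i)%N -> forall x : X i, normalized x -> x = 0.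
End Normalization.

(* Omega_p is presented as the quotient of the free (noncommutative) k-algebra *)
(* on t_0, ..., t_p, dt_0, ..., dt_p by the relations of graded commutativity, *)
(* with t_i of degree 0 and dt_i of degree 1, together with                    *)
(* t_0 + ... + t_p = 1 and dt_0 + ... + dt_p = 0.                              *)
Definition letter p := ('I_p.+1 + 'I_p.+1)%type.
Definition free_alg (k : fieldType) p := {malg k[{fmonom (letter p)}]}.
HB.instance Definition _ k p := GRing.Lalgebra.on (free_alg k p).

HB.lock Definition t_ (k : fieldType) p (i : 'I_p.+1) : free_alg k p :=
  << fmu (inl i : letter p) >>.
HB.lock Definition dt_ (k : fieldType) p (i : 'I_p.+1) : free_alg k p :=
  << fmu (inr i : letter p) >>.
Arguments t_ {k p} i.
Arguments dt_ {k p} i.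

Section Omega.
Variable k : fieldType.
Local Notation free_alg := (free_alg k).

Inductive omega_rel p : free_alg p -> Prop :=
| omega_tt i j : omega_rel (t_ i * t_ j - t_ j * t_ i)
| omega_tdt i j : omega_rel (t_ i * dt_ j - dt_ j * t_ i)
| omega_dtdt i j : omega_rel (dt_ i * dt_ j + dt_ j * dt_ i)
| omega_dt2 i : omega_rel (dt_ i * dt_ i)
| omega_sum_t : omega_rel (\sum_(i < p.+1) t_ i - 1)
| omega_sum_dt : omega_rel (\sum_(i < p.+1) dt_ i).

Definition omega p := {quot (ideal_pred (@omega_rel p))}.
HB.instance Definition _ p := GRing.Zmodule.on (omega p).

Definition omega_mk p (f : free_alg p) : omega p := \pi f.

Fact omega_mk_is_zmod_morphism p : zmod_morphism (@omega_mk p).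
Proof. exact: raddfB. Qed.

HB.instance Definition _ p :=
  GRing.isZmodMorphism.Build (free_alg p) (omega p) (@omega_mk p)
    (@omega_mk_is_zmod_morphism p).

Lemma omega_mk_eqP p (f g : free_alg p) :
  reflect (omega_mk f = omega_mk g) (f - g \in ideal_pred (@omega_rel p)).
Proof. exact: quot_eqP. Qed.

Lemma omega_mkK p (x : omega p) : omega_mk (repr x) = x.
Proof. exact: reprK. Qed.

Definition omega_scale p (c : k) (x : omega p) : omega p := omega_mk (c *: repr x).

Lemma omega_scale_mk p c (f : free_alg p) :
  omega_scale c (omega_mk f) = omega_mk (c *: f).
Proof.
apply/omega_mk_eqP; rewrite -scalerBr -[_ - _]mul1r scalerAl -[_ * _]mulr1.
by apply/ideal_predP/ideal_M/ideal_predP/repr_piP.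
Qed.

Fact omega_scaleA p a b (x : omega p) :
  omega_scale a (omega_scale b x) = omega_scale (a * b) x.
Proof.
rewrite -[x]omega_mkK; move: (repr x) => f.
by rewrite (omega_scale_mk b f) !omega_scale_mk scalerA.
Qed.

Fact omega_scale1 p : left_id 1 (@omega_scale p).
Proof. by move=> x; rewrite -[x]omega_mkK omega_scale_mk scale1r. Qed.

Fact omega_scaleDr p : right_distributive (@omega_scale p) +%R.
Proof.
move=> a x y; rewrite -[x]omega_mkK -[y]omega_mkK.
by rewrite -raddfD !omega_scale_mk -raddfD scalerDr.
Qed.

Fact omega_scaleDl p (x : omega p) :
  {morph (@omega_scale p)^~ x : a b / a + b}.
Proof.
by rewrite -[x]omega_mkK => a b; rewrite !omega_scale_mk -raddfD scalerDl.
Qed.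

HB.instance Definition _ p := GRing.Zmodule_isLmodule.Build k (omega p)
  (@omega_scaleA p) (@omega_scale1 p) (@omega_scaleDr p) (@omega_scaleDl p).

Fact omega_mk_is_scalable p : scalable (@omega_mk p).
Proof. by move=> c f; rewrite -[LHS]omega_scale_mk. Qed.

HB.instance Definition _ p :=
  GRing.isScalable.Build k (free_alg p) (omega p) *:%R (@omega_mk p)
    (@omega_mk_is_scalable p).

Definition word_degree p (w : {fmonom (letter p)}) : nat :=
  count (fun l : letter p => if l is inr _ then true else false) w.

Definition homogeneous n p (f : free_alg p) : Prop :=
  forall w, w \in msupp f -> word_degree w = n.

Lemma malgC_comm p (c : k) (f : free_alg p) : GRing.comm c%:MP f.
Proof.
rewrite /GRing.comm mul_malgC malgM_def fgmulgU malgZ_def.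
by apply: eq_bigr => w _; rewrite mulm1 mulrC.
Qed.

Lemma homogeneous0 n p : homogeneous n (0 : free_alg p).
Proof. by move=> w; rewrite msupp0. Qed.

Lemma homogeneousD n p (f g : free_alg p) :
  homogeneous n f -> homogeneous n g -> homogeneous n (f + g).
Proof.
move=> hf hg w /(fsubsetP (msuppD_le _ _)).
by rewrite in_fsetU => /orP[]; [exact: hf | exact: hg].
Qed.

Lemma homogeneousZ n p c (f : free_alg p) :
  homogeneous n f -> homogeneous n (c *: f).
Proof. by move=> hf w /(fsubsetP (msuppZ_le _ _)); exact: hf. Qed.

Lemma homogeneous_sum n p (J : Type) (s : seq J) (P : pred J) (F : J -> free_alg p) :
  (forall j, P j -> homogeneous n (F j)) -> homogeneous n (\sum_(j <- s | P j) F j).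
Proof.
by move=> hF; elim/big_ind: _ => //; [exact: homogeneous0 | exact: homogeneousD].
Qed.

Lemma homogeneousM m n p (f g : free_alg p) :
  homogeneous m f -> homogeneous n g -> homogeneous (m + n) (f * g).
Proof.
move=> hf hg w /msuppM_le[u [v [hu hv ->]]].
by rewrite /word_degree fmM count_cat [count _ u]hf // [count _ v]hg.
Qed.

Lemma homogeneous1 p : homogeneous 0 (1 : free_alg p).
Proof. by move=> w; rewrite msuppU1 => /fset1P ->; rewrite /word_degree fm1. Qed.

Definition form_pred n p : {pred omega p} :=
  fun x => `[< exists2 f : free_alg p, homogeneous n f & x = omega_mk f >].

Fact form_submod_closed n p : submod_closed (@form_pred n p).
Proof.
split; first by apply/asboolP; exists 0; [exact: homogeneous0 | rewrite raddf0].
move=> a _ _ /asboolP[f hf ->] /asboolP[g hg ->]; apply/asboolP.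
exists (a *: f + g); last by rewrite linearP.
by apply: homogeneousD => //; exact: homogeneousZ.
Qed.

HB.instance Definition _ n p :=
  GRing.isSubmodClosed.Build k (omega p) (@form_pred n p)
    (form_submod_closed n p).

(* Omega_p^n *)
Definition form n p := {x : omega p | form_pred n x}.
HB.instance Definition _ n p := SubChoice.on (form n p).
HB.instance Definition _ n p :=
  [SubChoice_isSubLmodule of form n p by <:].

(* alpha^* is the homomorphism of algebras with                                *)
(*   t_i |-> \sum_(alpha j = i) t_j,   dt_i |-> \sum_(alpha j = i) dt_j        *)
Section Pullback.
Variables (p q : nat) (a : delta p q).

Definition letter_pullback (l : letter q) : free_alg p :=
  match l with
  | inl i => \sum_(j < p.+1 | a j == i) t_ j
  | inr i => \sum_(j < p.+1 | a j == i) dt_ j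
  end.

Definition free_pullback (f : free_alg q) : free_alg p :=
  \sum_(w <- msupp f) f@_w *: \prod_(l <- w : seq _) letter_pullback l.

Let word_pullback (w : {fmonom (letter q)}) : free_alg p :=
  \prod_(l <- w : seq _) letter_pullback l.

Fact word_pullback_mmorphism : mmorphism word_pullback.
Proof.
by split=> [u v|]; rewrite /word_pullback ?fmM ?fm1 ?big_cat ?big_nil.
Qed.

HB.instance Definition _ :=
  isMultiplicative.Build _ _ word_pullback word_pullback_mmorphism.

Lemma free_pullbackE : free_pullback =1 mmap (@malgC _ k) word_pullback.
Proof. by move=> f; apply: eq_bigr => w _; rewrite mul_malgC. Qed.

Fact free_pullback_is_zmod_morphism : zmod_morphism free_pullback.
Proof. by move=> f g; rewrite !free_pullbackE raddfB. Qed.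

Fact free_pullback_is_monoid_morphism : monoid_morphism free_pullback.
Proof.
have [mM m1] : multiplicative (mmap (@malgC _ k) word_pullback).
  apply: commr_mmap_is_multiplicative => g m m'.
  exact: malgC_comm.
by split=> [|f g]; rewrite !free_pullbackE (m1, mM).
Qed.

Fact free_pullback_is_scalable : scalable free_pullback.
Proof.
move=> c f; have [_ fM] := free_pullback_is_monoid_morphism.
rewrite -!mul_malgC fM; congr (_ * _).
by rewrite free_pullbackE mmapU mmorph1 mulr1.
Qed.

HB.instance Definition _ :=
  GRing.isZmodMorphism.Build (free_alg q) (free_alg p) free_pullback
    free_pullback_is_zmod_morphism.
HB.instance Definition _ :=
  GRing.isMonoidMorphism.Build (free_alg q) (free_alg p) free_pullback
    free_pullback_is_monoid_morphism.
HB.instance Definition _ :=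
  GRing.isScalable.Build k (free_alg q) (free_alg p) *:%R free_pullback
    free_pullback_is_scalable.

Lemma free_pullbackU (l : letter q) : free_pullback << fmu l >> = letter_pullback l.
Proof.
by rewrite free_pullbackE mmapU mul1r /word_pullback fmU big_seq1.
Qed.

Local Notation I := (ideal_pred (@omega_rel p)).

Lemma free_pullback_ideal (f : free_alg q) :
  f \in ideal_pred (@omega_rel q) -> free_pullback f \in I.
Proof.
have sum_fibres (u : 'I_p.+1 -> free_alg p) :
    \sum_(i < q.+1) \sum_(j < p.+1 | a j == i) u j = \sum_(j < p.+1) u j.
  by rewrite [RHS](partition_big (delta_fun a) xpredT).
have pt i : free_pullback (t_ i) = \sum_(j < p.+1 | a j == i) t_ j.
  by rewrite {1}t_.unlock free_pullbackU.
have pdt i : free_pullback (dt_ i) = \sum_(j < p.+1 | a j == i) dt_ j.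
  by rewrite {1}dt_.unlock free_pullbackU.
move/ideal_predP; elim=> [_ [i j|i j|i j|i||]||f1 f2 _ IH1 _ IH2|f1 f2 g _ IH].
- apply: (ideal_commutator _ (pt i) (pt j)); exact: omega_tt.
- apply: (ideal_commutator _ (pt i) (pdt j)); exact: omega_tdt.
- apply: (ideal_anticommutator _ (pdt i) (pdt j)); exact: omega_dtdt.
- by apply: (ideal_square _ _ (pdt i)); [exact: omega_dtdt | exact: omega_dt2].
- rewrite rmorphB rmorph1 rmorph_sum (eq_bigr _ (fun i _ => pt i)) sum_fibres.
  exact/ideal_predP/ideal_in/omega_sum_t.
- rewrite rmorph_sum (eq_bigr _ (fun i _ => pdt i)) sum_fibres.
  exact/ideal_predP/ideal_in/omega_sum_dt.
- by rewrite raddf0 rpred0.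
- by rewrite raddfB; apply: rpredB; [exact: IH1 | exact: IH2].
- by rewrite 2!rmorphM; apply/ideal_predP/ideal_M/ideal_predP; exact: IH.
Qed.

Definition omega_pullback (x : omega q) : omega p :=
  omega_mk (free_pullback (repr x)).

Lemma omega_pullback_mk (f : free_alg q) :
  omega_pullback (omega_mk f) = omega_mk (free_pullback f).
Proof.
by apply/omega_mk_eqP; rewrite -raddfB; exact/free_pullback_ideal/repr_piP.
Qed.

Fact omega_pullback_is_linear : linear omega_pullback.
Proof.
move=> c x y; rewrite -[x]omega_mkK -[y]omega_mkK -linearP.
by rewrite !omega_pullback_mk !linearP.
Qed.

Lemma free_pullback_homogeneous n (f : free_alg q) :
  homogeneous n f -> homogeneous n (free_pullback f).
Proof.
move=> hf; rewrite /free_pullback big_seq; apply: homogeneous_sum => w /hf <-.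
apply: homogeneousZ; rewrite /word_degree.
elim: (w : seq _) => [|l s IHs]; first by rewrite big_nil; exact: homogeneous1.
rewrite big_cons; apply: homogeneousM => //; case: l => i /=.
  by apply: homogeneous_sum => j _ u; rewrite t_.unlock msuppU1 => /fset1P ->; rewrite /word_degree fmU.
by apply: homogeneous_sum => j _ u; rewrite dt_.unlock msuppU1 => /fset1P ->; rewrite /word_degree fmU.
Qed.

Fact omega_pullback_form n (x : form n q) : form_pred n (omega_pullback (val x)).
Proof.
have /asboolP[f hf ->] := valP x; apply/asboolP.
exists (free_pullback f); last exact: omega_pullback_mk.
exact: free_pullback_homogeneous.
Qed.

Definition form_pullback n (x : form n q) : form n p :=
  Sub (omega_pullback (val x)) (omega_pullback_form x).

Fact form_pullback_is_linear n : linear (@form_pullback n).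
Proof.
move=> c x y; apply: val_inj.
rewrite [RHS](linearP (val : form n p -> omega p)) -omega_pullback_is_linear.
by congr omega_pullback; exact: (linearP (val : form n q -> omega q)).
Qed.

HB.instance Definition _ n :=
  GRing.isLinear.Build k (form n q) (form n p) *:%R (@form_pullback n)
    (@form_pullback_is_linear n).
End Pullback.
End Omega.

Arguments form_pullback {k p q} a {n} x.

(* A is a k-algebra through phi : k -> A *)
Section ThomSullivan.
Variables (k : fieldType) (A : comPzRingType) (phi : {rmorphism k -> A}).
Variables (n : nat) (X : cosimplicial A).

Definition compatible (x : forall p, tensor phi (form k n p) (X p)) : Prop :=
  forall p q (a : delta p q),
    tensor_map phi (form_pullback a) (idfun : {linear X q -> X q}) (x q) =
    tensor_map phi (idfun : {linear form k n p -> form k n p}) (cs_map X a) (x p).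

Record thom_sullivan := ThomSullivan {
  ts_family :> forall p, tensor phi (form k n p) (X p);
  ts_compatible : compatible ts_family
}.

Lemma thom_sullivanP (x y : thom_sullivan) : (forall p, x p = y p) -> x = y.
Proof.
case: x y => x hx [y hy] /= xy; have {}xy : x = y by apply: functional_extensionality_dep.
by case: _ / xy in hy *; congr ThomSullivan; exact: Prop_irrelevance.
Qed.

HB.instance Definition _ := gen_eqMixin thom_sullivan.
HB.instance Definition _ := gen_choiceMixin thom_sullivan.

Fact ts_compatible0 : compatible (fun=> 0).
Proof. by move=> p q a; rewrite !raddf0. Qed.

Fact ts_compatibleN (x : thom_sullivan) : compatible (fun p => - x p).
Proof. by move=> p q a; rewrite [LHS]raddfN [RHS]raddfN; congr (- _); exact: ts_compatible. Qed.

Fact ts_compatibleD (x y : thom_sullivan) : compatible (fun p => x p + y p).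
Proof. by move=> p q a; rewrite [LHS]raddfD [RHS]raddfD; congr (_ + _); exact: ts_compatible. Qed.

Fact ts_compatibleZ (c : A) (x : thom_sullivan) : compatible (fun p => c *: x p).
Proof. by move=> p q a; rewrite [LHS]linearZ [RHS]linearZ; congr (_ *: _); exact: ts_compatible. Qed.

Let zero := ThomSullivan ts_compatible0.
Let opp x := ThomSullivan (ts_compatibleN x).
Let add x y := ThomSullivan (ts_compatibleD x y).
Let scale c x := ThomSullivan (ts_compatibleZ c x).

Fact ts_addA : associative add.
Proof. by move=> x y z; apply: thom_sullivanP => p /=; rewrite addrA. Qed.

Fact ts_addC : commutative add.
Proof. by move=> x y; apply: thom_sullivanP => p /=; rewrite addrC. Qed.

Fact ts_add0 : left_id zero add.
Proof. by move=> x; apply: thom_sullivanP => p /=; rewrite add0r. Qed.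

Fact ts_addN : left_inverse zero opp add.
Proof. by move=> x; apply: thom_sullivanP => p /=; rewrite addNr. Qed.

HB.instance Definition _ :=
  GRing.isZmodule.Build thom_sullivan ts_addA ts_addC ts_add0 ts_addN.

Fact ts_scaleA c d x : scale c (scale d x) = scale (c * d) x.
Proof. by apply: thom_sullivanP => p /=; rewrite scalerA. Qed.

Fact ts_scale1 : left_id 1 scale.
Proof. by move=> x; apply: thom_sullivanP => p /=; rewrite scale1r. Qed.

Fact ts_scaleDr : right_distributive scale +%R.
Proof. by move=> c x y; apply: thom_sullivanP => p /=; rewrite scalerDr. Qed.

Fact ts_scaleDl x : {morph scale^~ x : c d / c + d}.
Proof. by move=> c d; apply: thom_sullivanP => p /=; rewrite scalerDl. Qed.

HB.instance Definition _ := GRing.Zmodule_isLmodule.Build A thom_sullivan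
  ts_scaleA ts_scale1 ts_scaleDr ts_scaleDl.
End ThomSullivan.

(* Main.v *)
(** Everything rests on the multiplications by the barycentric coordinates t_i:
    they form a partition of unity of the simplicial module Omega^n, and t_i
    vanishes on the i-th face.  In a simplicial module every horn has a filler
    given by a linear formula in the degeneracies; if h_i fills the horn that
    misses the i-th face, then the sum of the t_i h_i fills the whole boundary.
    Dually, matching families of codegeneracies have fillers given by cofaces.
    Hence the p-th component of an element of Omega^n(X) is an explicit linear
    function of the (p-1)-st one plus an arbitrary element of Omega^n_p (x) X^p
    killed by all faces and all codegeneracies, and Omega^n(X) is a retract of
    the product over p of the flat modules Omega^n_p (x) X^p; only finitely many
    p matter when X is finite dimensional.  Flatness of the retract follows from
    the equational criterion, since over a noetherian ring the trivializations
    of one relation in all the factors can use the same finite set of syzygies. *)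

From HB Require Import structures.
Require Import Defs.
From mathcomp Require Import all_boot all_order all_algebra.
From mathcomp Require Import finmap boolp zify.
From mathcomp.multinomials Require Import monalg.

Set Implicit Arguments.
Unset Strict Implicit.
Unset Printing Implicit Defensive.

Import GRing.Theory.
Local Open Scope ring_scope.

(** * The equational criterion for flatness *)

(** A trivialization of the relations [a x = 0]: [x] is written with coefficients that are syzygies
    of [a]. Whole systems are treated at once because [tensor_kernel] has to trivialize several
    relations by the same elements. *)
Definition resolved (R : pzRingType) (M : lmodType R) q r (a : 'M[R]_(q, r))
    (x : 'I_r -> M) : Prop :=
  exists s (b : 'M[R]_(r, s)) (y : 'I_s -> M),
    a *m b = 0 /\ forall i, x i = \sum_j b i j *: y j.

Definition eq_flat (R : pzRingType) (M : lmodType R) : Prop :=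
  forall q r (a : 'M[R]_(q, r)) (x : 'I_r -> M),
    (forall i, \sum_j a i j *: x j = 0) -> resolved a x.

Section MatrixAction.
Variables (R : pzRingType) (M : lmodType R).

Lemma mulmx_act p q r (a : 'M[R]_(p, q)) (b : 'M[R]_(q, r)) (x : 'I_r -> M) i :
  \sum_j (a *m b) i j *: x j = \sum_l a i l *: \sum_j b l j *: x j.
Proof.
under eq_bigr do rewrite mxE scaler_suml.
rewrite exchange_big; apply: eq_bigr => l _; rewrite scaler_sumr.
by apply: eq_bigr => j _; rewrite scalerA.
Qed.

Lemma resolved0 q r (a : 'M[R]_(q, r)) : resolved a (fun=> 0 : M).
Proof.
exists 0, 0, (fun=> 0); split; first by rewrite mulmx0.
by move=> i; rewrite big_ord0.
Qed.

Lemma eq_resolved q r (a : 'M[R]_(q, r)) (x y : 'I_r -> M) :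
  x =1 y -> resolved a x -> resolved a y.
Proof. by move=> /funext ->. Qed.

Lemma resolvedD q r (a : 'M[R]_(q, r)) (x y : 'I_r -> M) :
  resolved a x -> resolved a y -> resolved a (fun i => x i + y i).
Proof.
move=> [s [b [u [ab xE]]]] [t [c [v [ac yE]]]].
exists (s + t)%N, (row_mx b c), (fun j => match split j with inl j => u j | inr j => v j end).
split; first by rewrite mul_mx_row ab ac row_mx0.
move=> i; rewrite big_split_ord xE yE; congr (_ + _); apply: eq_bigr => j _.
  by rewrite row_mxEl (unsplitK (inl j)).
by rewrite row_mxEr (unsplitK (inr j)).
Qed.

Lemma resolved_sum q r (a : 'M[R]_(q, r)) (I : eqType) (s : seq I) (x : I -> 'I_r -> M) :
  (forall l, l \in s -> resolved a (x l)) ->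
  resolved a (fun i => \sum_(l <- s) x l i).
Proof.
elim: s => [_|l s IHs xs].
  by apply: eq_resolved (resolved0 a) => i; rewrite big_nil.
have /resolvedD xl := xs l (mem_head _ _).
have /xl : resolved a (fun i => \sum_(j <- s) x j i).
  by apply: IHs => j js; apply: xs; rewrite inE js orbT.
by apply: eq_resolved => i; rewrite big_cons.
Qed.
End MatrixAction.

Lemma eq_flat_field (k : fieldType) (V : lmodType k) : eq_flat V.
Proof.
(* Since [a *m pinvmx a *m a = a], this matrix is a projector onto the kernel of [a]; it fixes [x]
   because [a x = 0]. *)
move=> q r a x ax; exists r, (1%:M - pinvmx a *m a), x; split.
  by rewrite mulmxBr mulmx1 mulmxA mulmxKpV ?submx_refl ?subrr.
move=> i; under eq_bigr do rewrite mxE scalerDl.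
rewrite big_split /= [X in _ + X](_ : _ = 0) ?addr0.
  rewrite (bigD1 i) //= big1 => [|j ji]; first by rewrite mxE eqxx scale1r addr0.
  by rewrite mxE eq_sym (negPf ji) scale0r.
under eq_bigr do rewrite mxE scaleNr.
rewrite sumrN mulmx_act big1 ?oppr0 // => l _.
by rewrite ax scaler0.
Qed.

(** * Kernels of linear maps and of their tensor products with flat modules *)

Section Kernel.
Variables (A : comPzRingType) (U V : lmodType A) (f : {linear U -> V}).

Definition kernel_pred : {pred U} := fun u => f u == 0.

Fact kernel_submod_closed : submod_closed kernel_pred.
Proof.
split=> [|c u v]; rewrite !unfold_in /=; first by rewrite raddf0.
by move=> /eqP fu /eqP fv; rewrite linearP fu fv scaler0 addr0.
Qed.

HB.instance Definition _ :=
  GRing.isSubmodClosed.Build A U kernel_pred kernel_submod_closed.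

Definition kernel := {u : U | kernel_pred u}.
HB.instance Definition _ := SubChoice.on kernel.
HB.instance Definition _ := [SubChoice_isSubLmodule of kernel by <:].

Lemma kernel_exact : exact_seq (val : {linear kernel -> U}) f.
Proof.
move=> u; split=> [fu|[v <-]]; last exact/eqP/(valP v).
by exists (exist _ u (introT eqP fu)).
Qed.
End Kernel.

Section Vanishing.
Variables (R : pzRingType) (S : comPzRingType) (phi : {rmorphism R -> S}).
Variables (M : lmodType R) (W : lmodType S).

Definition coef (k : seq (R * W)) (w : W) : R := \sum_(p <- k | p.2 == w) p.1.

Lemma coef_cons p k w : coef (p :: k) w = (if p.2 == w then p.1 else 0) + coef k w.
Proof. by rewrite /coef big_cons; case: ifP; rewrite ?add0r. Qed.

Lemma coef_nil w : coef [::] w = 0. Proof. exact: big_nil. Qed.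

(** Formal sums of pairs map to the direct sum of copies of [M] indexed by the elements of [W]; this
    is the component at [w]. *)
Definition fiber (z : {malg int[(M * W)%type]}) (w : W) : M :=
  free_lift (fun p : M * W => if p.2 == w then p.1 else 0) z.

Lemma fiberB z z' w : fiber (z - z') w = fiber z w - fiber z' w.
Proof. exact: raddfB. Qed.

Lemma fiberU m v w : fiber << (m, v) >> w = if v == w then m else 0.
Proof. exact: free_liftU. Qed.

(** The tensor product is the direct sum of copies of [M] indexed by [W], modulo the linear
    relations that hold in [W]. Each [l.1] is such a relation and [l.2] its multiplier. Additivity
    in [M] contributes no relation; additivity in [W] and balancing contribute one each. *)
Lemma vanishing z : subgroup_gen (@tensor_rel R S phi M W) z ->
  exists L : seq (seq (R * W) * M),
    (forall l, l \in L -> \sum_(p <- l.1) phi p.1 *: p.2 = 0) /\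
    forall w, fiber z w = \sum_(l <- L) coef l.1 w *: l.2.
Proof.
elim=> [_ [m m' n|m n n'|r m n]||x y _ [L [L0 LE]] _ [L' [L'0 L'E]]].
- exists [::]; split=> // w; rewrite big_nil !fiberB !fiberU.
  by case: eqP => _; rewrite ?subr0 // -addrA -opprD subrr.
- exists [:: ([:: (1, n + n'); (-1, n); (-1, n')], m)]; split=> [l|w].
    rewrite inE => /eqP -> /=; rewrite !big_cons big_nil /= rmorphN rmorph1.
    by rewrite !scaleN1r scale1r addr0 -opprD subrr.
  rewrite big_seq1 !coef_cons coef_nil /= !fiberB !fiberU !scalerDl scale0r addr0 addrA.
  by congr (_ + _ + _); case: ifP; rewrite ?scale1r ?scaleN1r ?scale0r ?oppr0.
- exists [:: ([:: (r, n); (-1, phi r *: n)], m)]; split=> [l|w].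
    rewrite inE => /eqP -> /=; rewrite !big_cons big_nil /= rmorphN rmorph1.
    by rewrite scaleN1r addr0 subrr.
  rewrite big_seq1 !coef_cons coef_nil /= !fiberB !fiberU !scalerDl scale0r addr0.
  by congr (_ + _); case: ifP; rewrite ?scaleN1r ?scale0r ?oppr0.
- by exists [::]; split=> // w; rewrite big_nil /fiber raddf0.
exists (L ++ [seq (l.1, - l.2) | l <- L']); split=> [l|w].
  by rewrite mem_cat => /orP[/L0 //|/mapP[l' /L'0 l'0 ->]].
rewrite fiberB LE L'E big_cat big_map -sumrN; congr (_ + _).
by apply: eq_bigr => l _ /=; rewrite scalerN.
Qed.
End Vanishing.

Lemma big_seq_pick (V : nmodType) (T : eqType) (D : seq T) x (F : T -> V) :
  uniq D -> x \in D -> \sum_(w <- D | x == w) F w = F x.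
Proof.
move=> uD xD; rewrite big_mkcond (bigD1_seq x) //= eqxx big1 ?addr0 // => w.
by rewrite eq_sym => /negPf ->.
Qed.

Section TensorKernel.
Variables (R : pzRingType) (S : comPzRingType) (phi : {rmorphism R -> S}).
Variables (M : lmodType R) (N N' : lmodType S) (g : {linear N -> N'}).
Local Notation tens := (tens phi).

Lemma tensDl (m m' : M) (v : N) : tens (m + m') v = tens m v + tens m' v.
Proof. by have [-> _ _] := tens_balanced phi M N. Qed.

Lemma tensDr (m : M) (v v' : N) : tens m (v + v') = tens m v + tens m v'.
Proof. by have [_ -> _] := tens_balanced phi M N. Qed.

Lemma tensZ r (m : M) (v : N) : tens (r *: m) v = tens m (phi r *: v).
Proof. by have [_ _ ->] := tens_balanced phi M N. Qed.

Lemma tens0l (v : N) : tens (0 : M) v = 0.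
Proof. by apply: (addrI (tens (0 : M) v)); rewrite -tensDl !addr0. Qed.

Lemma tens0r (m : M) : tens m (0 : N) = 0.
Proof. by apply: (addrI (tens m (0 : N))); rewrite -tensDr !addr0. Qed.

Lemma tensNl (m : M) (v : N) : tens (- m) v = - tens m v.
Proof. by apply: (addrI (tens m v)); rewrite -tensDl !subrr tens0l. Qed.

Lemma tens_suml I (r : seq I) (P : pred I) (m : I -> M) (v : N) :
  tens (\sum_(i <- r | P i) m i) v = \sum_(i <- r | P i) tens (m i) v.
Proof.
exact: (big_morph (fun x => tens x v) (fun x y => tensDl x y v) (tens0l v)).
Qed.

Lemma tens_sumr I (r : seq I) (P : pred I) (m : M) (v : I -> N) :
  tens m (\sum_(i <- r | P i) v i) = \sum_(i <- r | P i) tens m (v i).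
Proof. exact: (big_morph (fun x => tens m x) (tensDr m) (tens0r m)). Qed.

Lemma tensMz (m : M) (v : N) c : tens (m *~ c) v = tens m v *~ c.
Proof.
have natE n : tens (m *+ n) v = tens m v *+ n.
  by elim: n => [|n IHn]; rewrite ?mulr0n ?tens0l // !mulrS tensDl IHn.
by case: c => n; rewrite ?NegzE ?mulrNz ?tensNl -!pmulrn natE.
Qed.

Lemma tens_seq (y : tensor phi M N) :
  exists s : seq (M * N), y = \sum_(p <- s) tens p.1 p.2.
Proof.
exists [seq (p.1 *~ (repr y)@_p, p.2) | p <- msupp (repr y)].
by rewrite big_map [LHS]tens_sum; apply: eq_bigr => p _ /=; rewrite tensMz.
Qed.

Hypothesis flatM : eq_flat M.

(** The vanishing of the image is witnessed by linear relations in [N'], which may involve vectors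
    that do not occur in the image. Flatness of [M] recombines them into relations among the vectors
    [g p.2] alone, and these lift to elements of the kernel of [g]. *)
Lemma tensor_kernel (y : tensor phi M N) :
  tensor_map phi (idfun : {linear M -> M}) g y = 0 ->
  exists s : seq (M * N),
    y = \sum_(p <- s) tens p.1 p.2 /\ forall p, p \in s -> g p.2 = 0.
Proof.
have [s ->] := tens_seq y; rewrite raddf_sum /=.
under eq_bigr do rewrite tensor_mapE.
move=> s0; pose z : {malg int[(M * N')%type]} := \sum_(p <- s) << (p.1, g p.2) >>.
have /vanishing[L [L0 LE]] : subgroup_gen (@tensor_rel R S phi M N') z.
  apply/subgroup_predP/quot_eq0P; rewrite -[RHS]s0 raddf_sum.
  by apply: eq_bigr => p _; rewrite tens.unlock.
have zE w : fiber z w = \sum_(p <- s | g p.2 == w) p.1.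
  rewrite [LHS]raddf_sum [RHS]big_mkcond; apply: eq_bigr => p _.
  exact: fiberU.
pose im := [seq g p.2 | p <- s].
have ims p : p \in s -> g p.2 \in im by move=> ps; exact: map_f.
(* A duplicate-free support on which the image and all the relations can be summed. *)
pose D := undup (im ++ flatten [seq [seq p.2 | p <- l.1] | l <- L]).
have uD : uniq D := undup_uniq _.
have imD w : w \in im -> w \in D by rewrite mem_undup mem_cat => ->.
have LD l p : l \in L -> p \in l.1 -> p.2 \in D.
  move=> lL pl; rewrite mem_undup mem_cat; apply/orP; right.
  by apply/flatten_mapP; exists l; rewrite // map_f.
have sumD l : l \in L -> \sum_(w <- D) phi (coef l.1 w) *: w = 0.
  move=> lL; rewrite -[RHS](L0 l lL).
  under eq_bigr do rewrite rmorph_sum scaler_suml big_mkcond.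
  rewrite exchange_big; apply: eq_big_seq => p pl /=.
  by rewrite -big_mkcond (big_seq_pick (fun w => phi p.1 *: w)) // (LD l).
pose v w := (nth (0, 0) s (find (fun p => g p.2 == w) s)).2.
have gv w : w \in im -> g (v w) = w.
  case/mapP=> p ps ->; apply/eqP.
  by apply: (nth_find (0, 0) (a := fun p' => g p'.2 == g p.2)); apply/hasP; exists p.
(* Off [im] the components of [z] are zero, so each vector in [ex] imposes one linear equation on
   the multipliers [l.2]. Flatness trivializes this system. *)
pose ex := [seq w <- D | w \notin im].
pose a : 'M[R]_(size ex, size L) :=
  \matrix_(i, j) coef (tnth (in_tuple L) j).1 (tnth (in_tuple ex) i).
have [|t [b [y' [ab yE]]]] := flatM (a := a) (x := fun j => (tnth (in_tuple L) j).2).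
  move=> i; under eq_bigr do rewrite mxE.
  rewrite -(big_tnth _ _ _ xpredT (fun l => coef l.1 _ *: l.2)) -LE zE big1_seq // => p.
  case/andP=> /eqP gp ps; have := mem_tnth i (in_tuple ex).
  by rewrite mem_filter -gp ims.
(* The [j]-th recombined relation, lifted along the section [v] of [g]. By [a *m b = 0] it has no
   terms off [im], whence [g (v' j) = 0]. *)
pose v' j := \sum_(w <- D | w \in im) \sum_l
  phi (coef (tnth (in_tuple L) l).1 w * b l j) *: v w.
(* Each second factor is corrected by the chosen lift of its image. The corrections add up to the
   terms with [y' j] and [v' j]: both sums collect to [fiber z w] tensored with [v w], over [w] in
   [im]. *)
exists ([seq (p.1, p.2 - v (g p.2)) | p <- s] ++
        [seq (y' j, v' j) | j <- index_enum 'I_t]); split; last first.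
  move=> p; rewrite mem_cat => /orP[] /mapP[q qs ->] /=.
    by apply/eqP; rewrite raddfB subr_eq0; apply/eqP; symmetry; exact/gv/ims.
  rewrite raddf_sum; under eq_bigr do rewrite raddf_sum.
  have -> : \sum_(w <- D | w \in im) \sum_l
      g (phi (coef (tnth (in_tuple L) l).1 w * b l q) *: v w) =
    \sum_(w <- D | w \in im) \sum_l
      phi (coef (tnth (in_tuple L) l).1 w * b l q) *: w.
    by apply: eq_bigr => w wim; apply: eq_bigr => l _; rewrite linearZ; congr (_ *: _); exact: gv.
  pose F w := \sum_l phi (coef (tnth (in_tuple L) l).1 w * b l q) *: w.
  have F0 : \sum_(w <- D | w \notin im) F w = 0.
    rewrite -big_filter big_tnth big1 // => i _.
    rewrite /F -scaler_suml -rmorph_sum.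
    have := congr1 (fun m : 'M[R]_(_, _) => m i q) ab; rewrite mxE [RHS]mxE.
    under eq_bigr do rewrite mxE.
    by move=> ->; rewrite rmorph0 scale0r.
  transitivity (\sum_(w <- D) F w).
    by rewrite [RHS](bigID (mem im)) /= F0 addr0.
  rewrite exchange_big big1 // => l _.
  have -> : \sum_(w <- D) phi (coef (tnth (in_tuple L) l).1 w * b l q) *: w =
      phi (b l q) *: \sum_(w <- D) phi (coef (tnth (in_tuple L) l).1 w) *: w.
    rewrite scaler_sumr; apply: eq_bigr => w _.
    by rewrite scalerA rmorphM mulrC.
  by rewrite sumD ?scaler0 // mem_tnth.
rewrite big_cat !big_map /=.
have -> : \sum_(j < t) tens (y' j) (v' j) = \sum_(p <- s) tens p.1 (v (g p.2)).
  transitivity (\sum_(w <- D | w \in im) tens (fiber z w) (v w)).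
    rewrite /v'; under eq_bigr do rewrite tens_sumr.
    rewrite exchange_big; apply: eq_bigr => w _ /=.
    rewrite LE (big_tnth _ _ L) /= tens_suml.
    under eq_bigr do rewrite tens_sumr.
    rewrite exchange_big; apply: eq_bigr => l _ /=.
    rewrite yE scaler_sumr tens_suml; apply: eq_bigr => j _.
    by rewrite scalerA tensZ.
  under eq_bigr do rewrite zE tens_suml big_mkcond.
  rewrite exchange_big; apply: eq_big_seq => p ps /=.
  rewrite big_mkcond (bigD1_seq (g p.2)) ?imD ?ims //= eqxx big1 ?addr0 // => w.
  by rewrite eq_sym => /negPf ->; rewrite if_same.
by rewrite -big_split; apply: eq_bigr => p _ /=; rewrite -tensDr subrK.
Qed.
End TensorKernel.

(** * Equivalence of flatness with the equational criterion *)

Section Flatness.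
Variables (A : comPzRingType) (M : lmodType A).

Lemma tens_coord r (i : 'I_r) :
  exists h : {additive tensor (idfun : {rmorphism A -> A}) M 'cV[A]_r -> M},
    forall m c, h (tens _ m c) = c i 0 *: m.
Proof.
pose f (m : M) (c : 'cV[A]_r) := c i 0 *: m.
have fP : balanced (idfun : {rmorphism A -> A}) f.
  split=> [m m' c|m c c'|b m c]; first by rewrite /f scalerDr.
    by rewrite /f mxE scalerDl.
  by rewrite /f mxE scalerA mulrC.
have fB := tens_lift_zmod_morphism fP.
pose h : {additive tensor (idfun : {rmorphism A -> A}) M 'cV[A]_r -> M} :=
  HB.pack (tens_lift f) (GRing.isZmodMorphism.Build _ _ (tens_lift f) fB).
by exists h; move=> m c; exact: tens_liftE.
Qed.

(** The kernel of [a] on columns is tensored with [M]. The solution [x] becomes the sum of the [x j]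
    tensored with basis vectors; it lifts to the tensor product with the kernel, and the second
    factors of a lift are the columns of the required syzygy matrix. *)
Lemma flat_eq_flat : flat M -> eq_flat M.
Proof.
move=> flatM q r a x ax.
pose f : {linear 'cV[A]_r -> 'cV[A]_q} := mulmx a.
have [ex _] := flatM _ _ _ _ _ (kernel_exact f)
  (\sum_j tens (idfun : {rmorphism A -> A}) (x j) (delta_mx j 0)).
case: ex => [|u].
  rewrite raddf_sum /=.
  have colE' j : f (delta_mx j 0) = \sum_i a i j *: delta_mx i 0.
    rewrite /f /= -colE [LHS]matrix_sum_delta; apply: eq_bigr => i _.
    by rewrite big_ord1 mxE.
  under eq_bigr do rewrite tensor_mapE colE' tens_sumr.
  rewrite exchange_big big1 //= => i _.
  under eq_bigr do rewrite -[_ *: delta_mx _ _]/(idfun _ *: delta_mx _ _) -tensZ.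
  by rewrite -tens_suml ax tens0l.
have [s ->] := tens_seq u; rewrite raddf_sum.
rewrite (eq_bigr _ (fun p _ => tensor_mapE _ _ _ p.1 p.2)) => uE.
exists (size s), (\matrix_(i, l) val (tnth (in_tuple s) l).2 i 0),
  (fun l => (tnth (in_tuple s) l).1); split.
  apply/matrixP=> i l; have /eqP/matrixP/(_ i 0) := valP (tnth (in_tuple s) l).2.
  by rewrite !mxE => {2}<-; apply: eq_bigr => j _; rewrite mxE.
move=> i; under eq_bigr do rewrite mxE.
have [h hE] := tens_coord i.
transitivity (h (\sum_j tens _ (x j) (delta_mx j 0))).
  rewrite raddf_sum (bigD1 i) //= hE mxE !eqxx scale1r big1 ?addr0 // => j ji.
  by rewrite hE mxE eq_sym (negPf ji) scale0r.
rewrite -uE raddf_sum (big_tnth _ _ s); apply: eq_bigr => l _.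
exact: hE.
Qed.

Lemma eq_flat_flat : eq_flat M -> flat M.
Proof.
move=> flatM U V W f g fg v; split=> [/(tensor_kernel flatM)[s [-> s0]]|[u <-]].
  have [h hE] : {h : V -> U | forall p, p \in s -> f (h p.2) = p.2}.
    have /choice[h hE] : forall w : V, exists u, g w = 0 -> f u = w.
      move=> w; case: (pselect (g w = 0)) => [/fg[u <-]|w0]; first by exists u.
      by exists 0 => /w0.
    by exists h => p /s0; exact: hE.
  exists (\sum_(p <- s) tens _ p.1 (h p.2)); rewrite raddf_sum.
  apply: eq_big_seq => p ps; rewrite -[in RHS](hE p ps).
  exact: tensor_mapE.
apply: (tens_ext (f := tensor_map (idfun : {rmorphism A -> A}) (idfun : {linear M -> M}) g \o
  tensor_map idfun (idfun : {linear M -> M}) f) (g := fun=> 0)) => [x y|x y|m w] /=.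
- by rewrite !raddfB.
- by rewrite subr0.
rewrite 2!tensor_mapE (_ : g (f w) = 0) ?tens0r //.
by apply/fg; exists w.
Qed.
End Flatness.

(** * Tensor product of a vector space with a flat module *)

Section TensorFlat.
Variables (k : fieldType) (A : comPzRingType) (phi : {rmorphism k -> A}).
Variables (V : lmodType k) (M : lmodType A).

(** A vector with entries in the tensor product is one element [y] of [V] tensored with [M^r].
    Flatness of [V] over the field writes [y] with second factors that solve the system in [M], and
    flatness of [M] resolves each of these solutions. *)
Lemma eq_flat_tensor : eq_flat M -> eq_flat (tensor phi V M : lmodType A).
Proof.
move=> flatM q r a x ax.
pose g (y : {ffun 'I_r -> M}) := [ffun i => \sum_j a i j *: y j].
have glin : linear g.
  move=> c y z; apply/ffunP=> i; rewrite !ffunE scaler_sumr -big_split.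
  by apply: eq_bigr => j _; rewrite !ffunE scalerDr !scalerA mulrC.
pose g' : {linear {ffun 'I_r -> M} -> {ffun 'I_q -> M}} := HB.pack g
  (GRing.isLinear.Build _ _ _ _ _ glin).
have inj_lin n (j : 'I_n) : linear (fun m : M => [ffun i => if i == j then m else 0]).
  move=> c y z; apply/ffunP=> i; rewrite !ffunE.
  by case: eqP; rewrite ?scaler0 ?addr0.
pose inj n (j : 'I_n) : {linear M -> {ffun 'I_n -> M}} := HB.pack
  (fun m : M => [ffun i => if i == j then m else 0])
  (GRing.isLinear.Build _ _ _ _ _ (inj_lin n j)).
have pr_lin (j : 'I_r) : linear (fun y : {ffun 'I_r -> M} => y j).
  by move=> c y z; rewrite !ffunE.
pose pr (j : 'I_r) : {linear {ffun 'I_r -> M} -> M} := HB.pack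
  (fun y : {ffun 'I_r -> M} => y j)
  (GRing.isLinear.Build _ _ _ _ _ (pr_lin j)).
pose idV := (idfun : {linear V -> V}).
pose y := \sum_j tensor_map phi idV (inj r j) (x j).
have prE i : tensor_map phi idV (pr i) y = x i.
  have inj_pr j z : tensor_map phi idV (pr i) (tensor_map phi idV (inj r j) z) =
      if i == j then z else 0.
    apply: (tens_ext (f := tensor_map phi idV (pr i) \o tensor_map phi idV (inj r j))
        (g := fun z => if i == j then z else 0)) => [u v|u v|v m] /=.
    - by rewrite !raddfB.
    - by case: eqP; rewrite ?subr0.
    by rewrite 2!tensor_mapE /= ffunE; case: eqP => // _; rewrite tens0r.
  rewrite /y raddf_sum (eq_bigr _ (fun j _ => inj_pr j (x j))).
  by rewrite -big_mkcond (big_pred1 i) // => j; rewrite eq_sym.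
have [|s [yE s0]] := @tensor_kernel _ _ phi _ _ _ g' (@eq_flat_field k V) y.
  have inj_g j z : tensor_map phi idV g' (tensor_map phi idV (inj r j) z) =
      \sum_i tensor_map phi idV (inj q i) (a i j *: z).
    apply: (tens_ext (f := tensor_map phi idV g' \o tensor_map phi idV (inj r j))
        (g := fun z => \sum_i tensor_map phi idV (inj q i) (a i j *: z))) => [u v|u v|v m] /=.
    - by rewrite !raddfB.
    - by rewrite -sumrB; apply: eq_bigr => i _; rewrite scalerBr raddfB.
    rewrite 2!tensor_mapE; under eq_bigr do rewrite scale_tens tensor_mapE.
    rewrite -tens_sumr; congr tens; apply/ffunP=> i; rewrite ffunE sum_ffunE.
    under [RHS]eq_bigr do rewrite ffunE.
    rewrite -[RHS]big_mkcond (big_pred1 i) => [|l]; last by rewrite eq_sym.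
    rewrite (bigD1 j) //= ffunE eqxx big1 ?addr0 // => l lj.
    by rewrite ffunE (negPf lj) scaler0.
  rewrite /y raddf_sum (eq_bigr _ (fun j _ => inj_g j (x j))) exchange_big big1 //= => i _.
  by rewrite -raddf_sum ax raddf0.
apply: (@eq_resolved _ _ _ _ _ (fun i => \sum_(p <- s) tens phi p.1 (p.2 i))).
  move=> i; rewrite -[RHS]prE yE raddf_sum; apply: eq_bigr => p _.
  by symmetry; exact: tensor_mapE.
apply: resolved_sum => p /s0 gp.
have [i|t [b [m [ab mE]]]] := flatM _ _ a (fun i => p.2 i).
  by have /ffunP/(_ i) := gp; rewrite !ffunE.
exists t, b, (fun j => tens phi p.1 (m j)); split=> // i.
by rewrite mE tens_sumr; apply: eq_bigr => j _; rewrite scale_tens.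
Qed.
End TensorFlat.

(** * Finite generation of syzygies over a noetherian ring *)

Section Noetherian.
Variable A : comPzRingType.

Lemma mulmx_sum_colE r s (b : 'M[A]_(r, s)) (e : 'cV[A]_s) :
  b *m e = \sum_j e j 0 *: col j b.
Proof.
apply/matrixP=> i l; rewrite (ord1 l) mxE summxE; apply: eq_bigr => j _.
by rewrite !mxE mulrC.
Qed.

(** Induction on the rank: the first coordinates form a finitely generated ideal, and subtracting a
    combination of lifts of its generators leaves a column whose first coordinate is zero. *)
Lemma noetherian_submod r (N : 'cV[A]_r -> Prop) :
  noetherian A -> N 0 -> (forall a x y, N x -> N y -> N (a *: x + y)) ->
  exists s (b : 'M[A]_(r, s)),
    (forall j, N (col j b)) /\ forall c, N c -> exists e, c = b *m e.
Proof.
move=> noethA; have N_span n s (P : 'cV[A]_n -> Prop) (b : 'M[A]_(n, s)) e :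
    P 0 -> (forall a x y, P x -> P y -> P (a *: x + y)) ->
    (forall j, P (col j b)) -> P (b *m e).
  move=> P0 PD Pb; rewrite mulmx_sum_colE; elim/big_ind: _ => // [x y|j _].
    by move=> /(PD 1)/[apply]; rewrite scale1r.
  by rewrite -[_ *: _]addr0; exact: PD.
elim: r => [|r IHr] in N *; first move=> N0 ND.
  exists 0, 0; split=> [[]//|c _]; exists 0.
  by apply/matrixP=> -[].
move: N; rewrite -[r.+1]/(1 + r)%N => N N0 ND.
pose I x := exists2 c, N c & c 0 0 = x.
have [|s sE] := noethA I.
  split=> [|a _ _ [c Nc <-] [d Nd <-]]; first by exists 0; rewrite ?mxE.
  by exists (a *: c + d); [exact: ND | rewrite !mxE].
have /choice[c cP] : forall i : 'I_(size s), exists c, N c /\ c 0 0 = s`_i.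
  move=> i; have [|c Nc cE] := (sE s`_i).2; last by exists c.
  exists (fun j => (i == j)%:R); rewrite (bigD1 i) //= eqxx mul1r big1 ?addr0 // => j.
  by rewrite eq_sym => /negPf ->; rewrite mul0r.
pose b1 : 'M[A]_(1 + r, size s) := \matrix_(i, j) c j i 0.
have b1N j : N (col j b1).
  rewrite (_ : col j b1 = c j); first by have [] := cP j.
  by apply/matrixP=> i l; rewrite (ord1 l) !mxE.
have [||t [b2 [b2N b2E]]] := IHr (fun d : 'cV[A]_r => N (col_mx (0 : 'M_1) d)).
- by rewrite col_mx0.
- by move=> a x y Nx Ny; have := ND a _ _ Nx Ny; rewrite scale_col_mx add_col_mx scaler0 addr0.
exists (size s + t)%N, (row_mx b1 (col_mx (0 : 'M_(1, t)) b2)); split=> [j|d Nd].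
  by case: (split_ordP j) => l ->; rewrite ?colKl ?colKr // col_col_mx col0.
have [|e dE] := (sE (d 0 0)).1; first by exists d.
pose d' := d - b1 *m \col_j e j.
have Nd' : N d'.
  rewrite /d' addrC -scaleN1r; apply: (ND) => //.
  exact: N_span.
have d'E : d' = col_mx (0 : 'M_1) (dsubmx (d' : 'M_(1 + r, 1))).
  rewrite -[LHS](vsubmxK (d' : 'M_(1 + r, 1))); congr col_mx.
  apply/matrixP=> i j; rewrite !ord1 !mxE [lshift _ _](_ : _ = 0); last exact: val_inj.
  rewrite dE; apply/eqP; rewrite subr_eq0; apply/eqP/eq_bigr => l _.
  by rewrite !mxE (cP l).2 mulrC.
have [|f fE] := b2E (dsubmx (d' : 'M_(1 + r, 1))); first by rewrite -d'E; exact: Nd'.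
exists (col_mx (\col_j e j) f); rewrite mul_row_col mul_col_mx mul0mx -fE -d'E.
by rewrite addrC subrK.
Qed.

(** One finite matrix [b] serves every [c], with any number of columns; this is what allows
    infinitely many components to be treated together. *)
Lemma noetherian_syzygies q r (a : 'M[A]_(q, r)) : noetherian A ->
  exists s (b : 'M[A]_(r, s)),
    a *m b = 0 /\ forall t (c : 'M[A]_(r, t)), a *m c = 0 -> exists e, c = b *m e.
Proof.
move=> noethA; have [|c x y ax ay|s [b [b0 bE]]] :=
    @noetherian_submod r (fun c => a *m c = 0) noethA.
- exact: mulmx0.
- by rewrite mulmxDr -scalemxAr ax ay scaler0 addr0.
exists s, b; split=> [|t c ac].
  apply/matrixP=> i j; have /matrixP/(_ i 0) := b0 j; rewrite !mxE => h; rewrite -[RHS]h.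
  by apply: eq_bigr => l _; rewrite mxE.
have /choice[e eE] : forall j, exists e, col j c = b *m e.
  move=> j; apply: bE; apply/matrixP=> i l; rewrite (ord1 l).
  have /matrixP/(_ i j) := ac; rewrite !mxE => h; rewrite -[RHS]h.
  by apply: eq_bigr => l' _; rewrite mxE.
exists (\matrix_(i, j) e j i 0); apply/matrixP=> i j.
have /matrixP/(_ i 0) := eE j; rewrite !mxE => ->.
by apply: eq_bigr => l _; rewrite mxE.
Qed.
End Noetherian.

(** * Polynomial forms on simplices *)

Section FormFunctoriality.
Variable k : fieldType.
Local Notation free_alg := (free_alg k).

Lemma free_pullback_t p q (a : delta p q) i :
  free_pullback a (t_ i : free_alg q) = \sum_(j < p.+1 | a j == i) t_ j.
Proof. by rewrite {1}t_.unlock free_pullbackU. Qed.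

Lemma free_pullback_dt p q (a : delta p q) i :
  free_pullback a (dt_ i : free_alg q) = \sum_(j < p.+1 | a j == i) dt_ j.
Proof. by rewrite {1}dt_.unlock free_pullbackU. Qed.

Lemma delta_compE p q r (b : delta q r) (a : delta p q) i : delta_comp b a i = b (a i).
Proof. by rewrite /delta_fun /= ffunE. Qed.

Lemma delta_idE p i : delta_id p i = i.
Proof. by rewrite /delta_fun /= ffunE. Qed.

Lemma delta_ext p q (a b : delta p q) : a =1 b -> a = b.
Proof. by move=> ab; apply/val_inj/ffunP. Qed.

Lemma letter_pullback_comp p q r (b : delta q r) (a : delta p q) l :
  free_pullback a (letter_pullback k b l) = letter_pullback k (delta_comp b a) l.
Proof.
have fibres i (u : 'I_p.+1 -> free_alg p) :
    \sum_(j < q.+1 | b j == i) \sum_(l < p.+1 | a l == j) u l =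
    \sum_(l < p.+1 | delta_comp b a l == i) u l.
  rewrite [RHS](partition_big (delta_fun a) (fun j => b j == i)) => [|l'] /=.
    apply: eq_bigr => j /eqP <-; apply: eq_bigl => l'.
    by rewrite delta_compE; case: eqP => [->|]; rewrite ?eqxx ?andbF.
  by rewrite delta_compE.
case: l => i; rewrite /= raddf_sum.
  by rewrite (eq_bigr _ (fun j _ => free_pullback_t a j)) fibres.
by rewrite (eq_bigr _ (fun j _ => free_pullback_dt a j)) fibres.
Qed.

Lemma free_pullback_comp p q r (b : delta q r) (a : delta p q) (f : free_alg r) :
  free_pullback (delta_comp b a) f = free_pullback a (free_pullback b f).
Proof.
rewrite {1}/free_pullback /(free_pullback b) raddf_sum; apply: eq_bigr => w _.
rewrite [RHS]linearZ; congr (_ *: _); rewrite rmorph_prod.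
by apply: eq_bigr => l _; symmetry; exact: letter_pullback_comp.
Qed.

Lemma free_pullback_id p (f : free_alg p) : free_pullback (delta_id p) f = f.
Proof.
have lE l : letter_pullback k (delta_id p) l = << fmu l >>.
  case: l => i /=; rewrite (big_pred1 i) ?t_.unlock ?dt_.unlock // => j;
  by rewrite delta_idE.
have wE (w : seq (letter p)) : \prod_(l <- w) << fmu l >> = << FMonom w >> :> free_alg p.
  elim: w => [|l w IHw].
    by rewrite big_nil (_ : FMonom [::] = mone) //; apply/eqP; rewrite fmP fm1.
  rewrite big_cons IHw malgM_def fgmulUU mul1r (_ : mmul (fmu l) (FMonom w) = FMonom (l :: w)) //.
  by apply/eqP; rewrite fmP fmM fmU.
rewrite [RHS]monalgE; apply: eq_bigr => w _.
rewrite (eq_bigr _ (fun l _ => lE l)) wE fmK -mul_malgC malgM_def fgmulUU.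
by rewrite mulr1 mul1m.
Qed.

Lemma form_pullback_comp p q r (b : delta q r) (a : delta p q) n (x : Defs.form k n r) :
  form_pullback (delta_comp b a) x = form_pullback a (form_pullback b x).
Proof.
apply: val_inj => /=; rewrite -[val x]omega_mkK.
by rewrite !omega_pullback_mk free_pullback_comp.
Qed.

Lemma form_pullback_id p n (x : Defs.form k n p) : form_pullback (delta_id p) x = x.
Proof.
apply: val_inj => /=; rewrite -[val x]omega_mkK.
by rewrite omega_pullback_mk free_pullback_id.
Qed.
End FormFunctoriality.

(** * Multiplication of forms by barycentric coordinates *)

Lemma mulr_central_linear (K : pzRingType) (S : lalgType K) (c : K) (t f g : S) :
  GRing.comm c%:A t -> t * (c *: f + g) = c *: (t * f) + t * g.
Proof.
by move=> ct; rewrite mulrDr -[c *: f]mulr_algl mulrA -ct -mulrA mulr_algl.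
Qed.

Section BarycentricMultiplication.
Variable k : fieldType.
Local Notation free_alg := (free_alg k).

Definition omega_t p (i : 'I_p.+1) (x : omega k p) : omega k p :=
  omega_mk (t_ i * repr x).

Lemma omega_t_mk p (i : 'I_p.+1) (f : free_alg p) :
  omega_t i (omega_mk f) = omega_mk (t_ i * f).
Proof.
apply/omega_mk_eqP; rewrite -mulrBr -[_ * _]mulr1.
exact/ideal_predP/ideal_M/ideal_predP/repr_piP.
Qed.

Lemma malg_alg_comm p c (f : free_alg p) : GRing.comm (c%:A : free_alg p) f.
Proof. by rewrite -mul_malgC mulr1; exact: malgC_comm. Qed.

Lemma omega_mk_linear p c (f g : free_alg p) :
  omega_mk (c *: f + g) = c *: omega_mk f + omega_mk g.
Proof. exact: linearP. Qed.

Fact omega_t_is_linear p (i : 'I_p.+1) : linear (omega_t i).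
Proof.
move=> c x y; rewrite -[x]omega_mkK -[y]omega_mkK.
move: (repr x) (repr y) => f g.
apply: etrans (congr1 (omega_t i) (esym (omega_mk_linear c f g))) _.
apply: etrans (omega_t_mk i (c *: f + g)) _.
apply: etrans (congr1 (@omega_mk k p) (mulr_central_linear f g (malg_alg_comm c (t_ i)))) _.
apply: etrans (omega_mk_linear c (t_ i * f) (t_ i * g)) _.
by rewrite (omega_t_mk i f) (omega_t_mk i g).
Qed.

Fact omega_t_form n p (i : 'I_p.+1) (x : Defs.form k n p) : form_pred n (omega_t i (val x)).
Proof.
have /asboolP[f hf ->] := valP x; apply/asboolP.
exists (t_ i * f); last exact: omega_t_mk.
apply: (@homogeneousM _ 0) => // w.
by rewrite t_.unlock msuppU1 => /fset1P ->; rewrite /word_degree fmU.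
Qed.

Definition form_t n p (i : 'I_p.+1) (x : Defs.form k n p) : Defs.form k n p :=
  Sub (omega_t i (val x)) (omega_t_form i x).

Fact form_t_is_linear n p (i : 'I_p.+1) : linear (@form_t n p i).
Proof.
move=> c x y; apply: val_inj.
rewrite [RHS](linearP (val : Defs.form k n p -> omega k p)) -omega_t_is_linear.
by congr omega_t; exact: (linearP (val : Defs.form k n p -> omega k p)).
Qed.

HB.instance Definition _ n p (i : 'I_p.+1) :=
  GRing.isLinear.Build k (Defs.form k n p) (Defs.form k n p) *:%R (@form_t n p i)
    (@form_t_is_linear n p i).

Lemma sum_form_t n p (x : Defs.form k n p) : \sum_i form_t i x = x.
Proof.
apply: val_inj; rewrite (raddf_sum (val : Defs.form k n p -> omega k p)) /=.
rewrite -[val x]omega_mkK (eq_bigr _ (fun i _ => omega_t_mk i (repr (val x)))).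
rewrite -raddf_sum -mulr_suml; apply/omega_mk_eqP.
rewrite -[X in _ - X]mul1r -mulrBl -[X in X * _]mul1r.
exact/ideal_predP/ideal_M/ideal_in/omega_sum_t.
Qed.

(** For the coface that misses [i] the sum is empty, which says that [t_ i] vanishes on the opposite
    face. *)
Lemma form_pullback_t n p q (a : delta p q) i (x : Defs.form k n q) :
  form_pullback a (form_t i x) = \sum_(j < p.+1 | a j == i) form_t j (form_pullback a x).
Proof.
apply: val_inj; rewrite (raddf_sum (val : Defs.form k n p -> omega k p)) /=.
rewrite -[val x]omega_mkK omega_t_mk !omega_pullback_mk.
rewrite (eq_bigr _ (fun j _ => omega_t_mk j _)) -raddf_sum -mulr_suml.
by rewrite rmorphM -free_pullback_t.
Qed.
End BarycentricMultiplication.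

(** * Fillers *)

Lemma ord_enum_pairwise n : pairwise (fun x y : 'I_n => (x < y)%N) (ord_enum n).
Proof.
rewrite -(pairwise_map val ltn) val_ord_enum.
by rewrite -(sorted_pairwise ltn_trans) iota_ltn_sorted.
Qed.

(** * Cofaces, codegeneracies and the filling order of a horn *)

Section FacesDegeneracies.
Variable m : nat.

Fact nondecr_coface (i : 'I_m.+2) : nondecr [ffun x : 'I_m.+1 => lift i x].
Proof.
apply/'forall_forallP=> x y; apply/implyP=> lexy.
by rewrite !ffunE /= /bump; lia.
Qed.

Definition coface (i : 'I_m.+2) : delta m m.+1 := Sub _ (nondecr_coface i).

Lemma cofaceE i x : coface i x = bump i x :> nat.
Proof. by rewrite /delta_fun /= ffunE. Qed.

Lemma codegenE (j : 'I_m.+1) x : delta_codegen j x = unbump j x :> nat.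
Proof.
rewrite /delta_fun /= ffunE inordK // /unbump.
by have := ltn_ord x; have := ltn_ord j; lia.
Qed.

Lemma codegen_coface_id (j : 'I_m.+1) (i : 'I_m.+2) :
  i = j :> nat \/ i = j.+1 :> nat -> delta_comp (delta_codegen j) (coface i) = delta_id m.
Proof.
move=> ij; apply: delta_ext => x; apply: ord_inj.
rewrite delta_compE delta_idE codegenE cofaceE /bump /unbump; lia.
Qed.

(* The faces k <> i of a horn are filled upwards below i, then downwards above *)
(* i: the retraction below moves k to k + 1 or k - 1, towards i, hence never   *)
(* onto a face that has already been filled.                                   *)
Definition horn_degen (i k : 'I_m.+2) : delta m.+1 m :=
  delta_codegen (if (k < i)%N then inord k else inord k.-1 : 'I_m.+1).

Definition horn_order (i k' k : 'I_m.+2) : bool :=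
  if (k < i)%N then (k' < k)%N else (i < k)%N && ((k' < i)%N || (k < k')%N).

Lemma horn_degenE i k x : k != i ->
  horn_degen i k x = unbump (if (k < i)%N then k : nat else k.-1) x :> nat.
Proof.
rewrite -val_eqE /= => ki; rewrite codegenE; congr unbump.
by have := ltn_ord k; have := ltn_ord i; case: ifP => ? ? ?; rewrite inordK //; lia.
Qed.

Lemma horn_degen_coface i k : k != i -> delta_comp (horn_degen i k) (coface k) = delta_id m.
Proof.
move=> ki; apply: delta_ext => x; apply: ord_inj.
rewrite delta_compE delta_idE horn_degenE // cofaceE.
move: ki; rewrite -val_eqE /= /bump /unbump; case: ifP; lia.
Qed.

(** The composite on the left never takes the value [k'], so it factors through [coface k']; the
    factor is recovered with the retraction [horn_degen i k']. Hence the correction made at [k]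
    leaves the earlier face [k'] intact. *)
Lemma horn_swap i k' k : k' != i -> k != i -> horn_order i k' k ->
  exists g, delta_comp (coface k) (delta_comp (horn_degen i k) (coface k')) =
            delta_comp (coface k') g.
Proof.
move=> k'i ki ord.
exists (delta_comp (horn_degen i k')
  (delta_comp (coface k) (delta_comp (horn_degen i k) (coface k')))).
apply: delta_ext => x; apply: ord_inj.
rewrite !delta_compE !cofaceE !horn_degenE // !cofaceE !horn_degenE // !cofaceE.
move: k'i ki ord; rewrite /horn_order -!val_eqE /= /bump /unbump.
by case: (ltnP k i); case: (ltnP k' i); lia.
Qed.

(** Dually, the composite identifies the vertices [i] and [i + 1], so it factors through
    [delta_codegen i]; the factor is obtained by composing with a section. *)
Lemma codegen_swap (i j : 'I_m.+1) : (i < j)%N ->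
  exists g, delta_comp (delta_comp (delta_codegen i) (coface (inord j.+1))) (delta_codegen j) =
            delta_comp g (delta_codegen i).
Proof.
move=> ij; pose c := delta_comp (delta_comp (delta_codegen i) (coface (inord j.+1)))
  (delta_codegen j); exists (delta_comp c (coface (inord i))).
apply: delta_ext => x; apply: ord_inj; rewrite /c !delta_compE.
rewrite !codegenE !cofaceE !codegenE !cofaceE !codegenE.
have [im jm] := (ltn_ord i, ltn_ord j).
rewrite !inordK ?ltnS ?(ltnW im) // /bump /unbump; lia.
Qed.

Definition horn_seq (i : 'I_m.+2) : seq 'I_m.+2 :=
  [seq k : 'I_m.+2 <- ord_enum m.+2 | (k < i)%N] ++
  rev [seq k : 'I_m.+2 <- ord_enum m.+2 | (i < k)%N].

Lemma mem_horn_seq i k : (k \in horn_seq i) = (k != i).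
Proof.
rewrite mem_cat mem_rev !mem_filter mem_ord_enum !andbT -neq_ltn.
by rewrite -val_eqE.
Qed.

Lemma horn_seq_pairwise i : pairwise (horn_order i) (horn_seq i).
Proof.
have lt_enum a := pairwise_filter a (ord_enum_pairwise m.+2).
rewrite pairwise_cat; apply/and3P; split.
- apply/allrelP=> x y; rewrite mem_rev !mem_filter => /andP[xi _] /andP[iy _].
  by rewrite /horn_order; case: ltnP; lia.
- apply: (sub_in_pairwise (P := fun x : 'I_m.+2 => (x < i)%N)) (lt_enum _).
    by move=> x y; rewrite !unfold_in /horn_order => xi ->.
  exact: filter_all.
apply: (sub_in_pairwise (P := fun x : 'I_m.+2 => (i < x)%N)
    (r := fun x y : 'I_m.+2 => (y < x)%N)).
- by move=> x y; rewrite !unfold_in /horn_order => ix iy yx; case: ltnP; lia.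
- by rewrite all_rev filter_all.
rewrite -sorted_pairwise => [|x y z xy yz]; last exact: ltn_trans yz xy.
by rewrite rev_sorted; exact: pairwise_sorted.
Qed.
End FacesDegeneracies.

(** * Filling by successive corrections *)

Section Filling.
Variables (A : pzRingType) (W U : lmodType A) (I : eqType).
Variables (d : I -> {linear W -> U}) (e : I -> {linear U -> W}).

Definition fill (L : seq I) (u : I -> U) : W :=
  foldl (fun w j => w + e j (u j - d j w)) 0 L.

Lemma fill_rcons L j u :
  fill (rcons L j) u = fill L u + e j (u j - d j (fill L u)).
Proof. by rewrite /fill foldl_rcons. Qed.

(** A correction is exact at its own index because [e j] is a section of [d j], and invisible at the
    earlier indices by the swap condition. Faces with degeneracies give horn fillers; codegeneracies
    with cofaces give the dual fillers. *)
Lemma fillP (r : rel I) (L : seq I) (u : I -> U) :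
  (forall j x, j \in L -> d j (e j x) = x) ->
  (forall i j w, i \in L -> j \in L -> r i j -> d i w = u i ->
     d i (e j (u j - d j w)) = 0) ->
  pairwise r L -> forall j, j \in L -> d j (fill L u) = u j.
Proof.
elim/last_ind: L => // L j IHL de swap.
rewrite pairwise_rcons fill_rcons => /andP[/allP rL pL] i.
rewrite mem_rcons inE => /predU1P[->|iL].
  by rewrite linearD de ?mem_rcons ?mem_head // addrC subrK.
have iE : d i (fill L u) = u i.
  apply: IHL => // [i' x i'L|i' j' w i'L j'L]; first by apply: de; rewrite mem_rcons inE i'L orbT.
  by apply: swap; rewrite mem_rcons inE ?i'L ?j'L orbT.
by rewrite linearD iE (swap i) ?addr0 ?mem_rcons ?mem_head // ?inE ?iL ?orbT ?rL.
Qed.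

Lemma fill_linear L c u v :
  fill L (fun j => c *: u j + v j) = c *: fill L u + fill L v.
Proof.
elim/last_ind: L => [|L j IHL]; first by rewrite /fill scaler0 addr0.
rewrite !fill_rcons IHL linearP opprD addrACA -scalerBr linearP.
by rewrite scalerDr addrACA.
Qed.
End Filling.

Lemma fill_natural (A : pzRingType) (W U W' U' : lmodType A) (I : eqType)
    (d : I -> {linear W -> U}) (e : I -> {linear U -> W})
    (d' : I -> {linear W' -> U'}) (e' : I -> {linear U' -> W'})
    (f : {linear W -> W'}) (g : {linear U -> U'}) L u :
  (forall j w, g (d j w) = d' j (f w)) -> (forall j x, f (e j x) = e' j (g x)) ->
  f (fill d e L u) = fill d' e' L (fun j => g (u j)).
Proof.
move=> gd fe; elim/last_ind: L => [|L j IHL]; first exact: raddf0.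
by rewrite !fill_rcons linearD fe linearB gd IHL.
Qed.

(** * Generation of monotone maps by cofaces and codegeneracies *)

Section Generators.
Variables (P : forall p q, delta p q -> Prop) (N : nat).
Hypothesis P_id : forall p, P (delta_id p).
Hypothesis P_comp : forall p q r (b : delta q r) (a : delta p q),
  P b -> P a -> P (delta_comp b a).
Hypothesis P_coface : forall m (i : 'I_m.+2), (m < N)%N -> P (coface i).
Hypothesis P_codegen : forall m (j : 'I_m.+1), (m < N)%N -> P (delta_codegen j).

Lemma increasing_delta_id p q (a : delta p q) :
  (forall x y : 'I_p.+1, (x < y)%N -> (a x < a y)%N) ->
  (forall y, exists x, a x = y) -> P a.
Proof.
move=> a_inc a_surj.
have aE : [seq val (a x) | x <- ord_enum p.+1] = iota 0 q.+1.
  apply: (irr_sorted_eq ltn_trans ltnn) => [||y].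
  - rewrite (sorted_pairwise ltn_trans) pairwise_map.
    apply: (@sub_pairwise _ (relpre val ltn)); first by move=> x y; exact: a_inc.
    exact: ord_enum_pairwise.
  - exact: iota_ltn_sorted.
  rewrite mem_iota add0n /=; apply/mapP/idP => [[x _ ->]|yq]; first exact: ltn_ord.
  by have [x ax] := a_surj (Ordinal yq); exists x; rewrite ?mem_ord_enum ?ax.
have size_ord n : size (ord_enum n) = n.
  by rewrite -(size_map val) val_ord_enum size_iota.
have pq : p = q.
  by have := congr1 size aE; rewrite size_map size_ord size_iota => -[].
case: _ / pq in a aE {a_inc a_surj} *.
rewrite (_ : a = delta_id p) //; apply: delta_ext => x; apply: ord_inj.
rewrite delta_idE -[RHS]add0n -(nth_iota 0 0 (ltn_ord x)) -aE.
rewrite (nth_map x) ?size_ord //; congr (val (a _)); apply: ord_inj.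
by rewrite -(nth_map x 0 val) ?size_ord // val_ord_enum nth_iota.
Qed.

(** Induction on [p + q]: two neighbours with equal values split off a codegeneracy, a missed value
    splits off a coface, and otherwise the map is an identity. No intermediate object exceeds [N],
    so the principle applies where [P] is known only up to a given stage. *)
Lemma delta_generated p q (a : delta p q) : (p <= N)%N -> (q <= N)%N -> P a.
Proof.
move: {2}(p + q).+1 (ltnSn (p + q)) => n.
elim: n p q a => // n IHn p q a pqn pN qN.
have [a_inc|] := pselect (forall x y : 'I_p.+1, (x < y)%N -> (a x < a y)%N); last first.
  move=> /existsNP[x /existsNP[y /not_implyP[xy /negP]]]; rewrite -leqNgt => ayx.
  case: p => [|p] in a x y xy ayx pqn pN *.
    by have := ltn_ord y; lia.
  have xp : (x < p.+1)%N by have := ltn_ord y; lia.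
  have xE : inord x = x :> 'I_p.+2 by apply: ord_inj; rewrite inordK //; lia.
  have ax : a (inord x.+1) = a x.
    apply: ord_inj; apply/eqP; rewrite eqn_leq; apply/andP; split.
      apply: leq_trans ayx; apply: nondecrP; rewrite inordK //; lia.
    by apply: nondecrP; rewrite inordK //; lia.
  rewrite (_ : a = delta_comp (delta_comp a (coface (inord x.+1)))
      (delta_codegen (Ordinal xp))).
    by apply: P_comp; [apply: IHn; lia | exact: P_codegen].
  apply: delta_ext => z; rewrite !delta_compE.
  have [zx|zx] := eqVneq (z : nat) x.+1.
    rewrite (_ : z = inord x.+1) ?ax; last by apply: ord_inj; rewrite inordK ?zx //; lia.
    congr (a _); apply: ord_inj.
    by rewrite cofaceE codegenE /= !inordK /bump /unbump; lia.
  congr (a _); apply: ord_inj.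
  by rewrite cofaceE codegenE /= !inordK; rewrite ?/bump ?/unbump; lia.
have [a_surj|] := pselect (forall y, exists x, a x = y).
  exact: increasing_delta_id.
move=> /existsNP[y /forallNP ay].
case: q => [|q] in a a_inc y ay pqn qN *.
  by case: (ay ord0); rewrite [y]ord1 [LHS]ord1.
(* The codegeneracy has to retract [coface y]; the minimum covers the last vertex [y = q + 1], which
   is not an index of a codegeneracy. *)
rewrite (_ : a = delta_comp (coface y) (delta_comp (delta_codegen (inord (minn y q))) a)).
  by apply: P_comp; [exact: P_coface | apply: IHn; lia].
apply: delta_ext => x; apply: ord_inj; rewrite !delta_compE cofaceE codegenE.
have : val (a x) <> val y by move/val_inj; exact: ay.
rewrite inordK; last by have := ltn_ord y; lia.
by have := ltn_ord (a x); have := ltn_ord y; rewrite /= /bump /unbump; lia.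
Qed.
End Generators.

Lemma sub_lincomb (A : pzRingType) (M : lmodType A) c (x y x' y' : M) :
  c *: x + y - (c *: x' + y') = c *: (x - x') + (y - y').
Proof. by rewrite opprD addrACA scalerBr. Qed.

(** * Fillers for prescribed codegeneracies *)

Section Cofilling.
Variables (A : pzRingType).

(** Testing endomaps of [[m]] suffices for the filling, and for the families built from a diagonal
    element the condition then reduces to compatibility with endomaps, [endo_x]. *)
Definition comatching (Y : cosimplicial A) m (y : 'I_m.+1 -> Y m) : Prop :=
  forall i j (c g : delta m m),
    delta_comp c (delta_codegen i) = delta_comp g (delta_codegen j) ->
    cs_map Y c (y i) = cs_map Y g (y j).

Definition cofill (Y : cosimplicial A) m (y : 'I_m.+1 -> Y m) : Y m.+1 :=
  fill (fun j => cs_map Y (delta_codegen j))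
       (fun j : 'I_m.+1 => cs_map Y (coface (inord j.+1))) (ord_enum m.+1) y.

Lemma cofillP (Y : cosimplicial A) m (y : 'I_m.+1 -> Y m) k :
  comatching y -> cs_map Y (delta_codegen k) (cofill y) = y k.
Proof.
move=> my; apply: (fillP (r := fun i j : 'I_m.+1 => (i < j)%N)) => [j x _|i j w _ _ ij iw||].
- rewrite -cs_map_comp codegen_coface_id ?cs_map_id //.
  by right; rewrite inordK //; have := ltn_ord j; lia.
- have [g gE] := codegen_swap ij.
  rewrite -cs_map_comp linearB -[X in _ - X]cs_map_comp gE (my j i _ g gE).
  by rewrite cs_map_comp iw subrr.
- exact: ord_enum_pairwise.
exact: mem_ord_enum.
Qed.

Lemma cofill_linear (Y : cosimplicial A) m c (y y' : 'I_m.+1 -> Y m) :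
  cofill (fun j => c *: y j + y' j) = c *: cofill y + cofill y'.
Proof. exact: fill_linear. Qed.

Lemma cofill0 (Y : cosimplicial A) m : cofill (fun=> 0 : Y m) = 0.
Proof.
by have := cofill_linear (-1) (fun=> 0 : Y m) (fun=> 0); rewrite scaler0 addr0 scaleN1r addNr.
Qed.

Lemma eq_cofill (Y : cosimplicial A) m (y y' : 'I_m.+1 -> Y m) :
  y =1 y' -> cofill y = cofill y'.
Proof. by move=> /funext ->. Qed.

Lemma cofill_natural (Y Y' : cosimplicial A) (f : forall r, {linear Y r -> Y' r}) m
    (y : 'I_m.+1 -> Y m) :
  (forall r s (b : delta r s) x, f s (cs_map Y b x) = cs_map Y' b (f r x)) ->
  f m.+1 (cofill y) = cofill (fun j => f m (y j)).
Proof. by move=> fY; apply: fill_natural => j x; exact: fY. Qed.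
End Cofilling.

(** * Simplicial cosimplicial modules with a partition of unity *)

Section Bisimplicial.
Variables (A : pzRingType) (Z : nat -> cosimplicial A).
Variable V : forall p q r, delta p q -> {linear Z q r -> Z p r}.
Hypothesis V_id : forall p r (z : Z p r), V r (delta_id p) z = z.
Hypothesis V_comp : forall p q s r (b : delta q s) (a : delta p q) (z : Z s r),
  V r (delta_comp b a) z = V r a (V r b z).
Hypothesis V_cs : forall p q r s (a : delta p q) (b : delta r s) (z : Z q r),
  V s a (cs_map (Z q) b z) = cs_map (Z p) b (V r a z).
Variable T : forall p r, 'I_p.+1 -> {linear Z p r -> Z p r}.
Hypothesis T_sum : forall p r (z : Z p r), \sum_i T r i z = z.
Hypothesis V_T : forall p q r (a : delta p q) i (z : Z q r),
  V r a (T r i z) = \sum_(j < p.+1 | a j == i) T r j (V r a z).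
Hypothesis T_cs : forall p r s (i : 'I_p.+1) (b : delta r s) (z : Z p r),
  T s i (cs_map (Z p) b z) = cs_map (Z p) b (T r i z).

Definition matching m r (u : 'I_m.+2 -> Z m r) : Prop :=
  forall i j (c g : delta m m),
    delta_comp (coface i) c = delta_comp (coface j) g -> V r c (u i) = V r g (u j).

Definition horn_fill m r i (u : 'I_m.+2 -> Z m r) : Z m.+1 r :=
  fill (fun k => V r (coface k)) (fun k => V r (horn_degen i k)) (horn_seq i) u.

Definition face_fill m r (u : 'I_m.+2 -> Z m r) : Z m.+1 r :=
  \sum_i T r i (horn_fill i u).

Lemma horn_fillP m r i k (u : 'I_m.+2 -> Z m r) :
  matching u -> k != i -> V r (coface k) (horn_fill i u) = u k.
Proof.
move=> mu ki; apply: (fillP (r := horn_order i)); last by rewrite mem_horn_seq.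
- by move=> j x; rewrite mem_horn_seq => ji; rewrite -V_comp horn_degen_coface // V_id.
- move=> k' j w; rewrite !mem_horn_seq => k'i ji ord k'w.
  have [g gE] := horn_swap k'i ji ord.
  rewrite -V_comp linearB -[X in _ - X]V_comp gE (mu j k' _ g gE).
  by rewrite V_comp k'w subrr.
exact: horn_seq_pairwise.
Qed.

(** No vertex of the [k]-th face maps to [k], so the one horn filler that may be wrong there has
    weight zero. All others restrict to [u k], and the weights add up to one. *)
Lemma face_fillP m r k (u : 'I_m.+2 -> Z m r) :
  matching u -> V r (coface k) (face_fill u) = u k.
Proof.
move=> mu; rewrite raddf_sum -[RHS]T_sum.
rewrite [RHS](partition_big (coface k) xpredT) //=; apply: eq_bigr => i _.
rewrite V_T; apply: eq_bigr => j /eqP ji; rewrite horn_fillP //.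
by apply/eqP=> ki; have := cofaceE k j; rewrite ji ki /bump; lia.
Qed.

Lemma face_fill_linear m r c (u v : 'I_m.+2 -> Z m r) :
  face_fill (fun k => c *: u k + v k) = c *: face_fill u + face_fill v.
Proof.
rewrite /face_fill scaler_sumr -big_split; apply: eq_bigr => i _.
by rewrite /horn_fill fill_linear linearP.
Qed.

Lemma face_fill0 m r : face_fill (fun=> 0 : Z m r) = 0.
Proof.
by have := face_fill_linear (-1) (fun=> 0 : Z m r) (fun=> 0); rewrite scaler0 addr0 scaleN1r addNr.
Qed.

Lemma eq_face_fill m r (u v : 'I_m.+2 -> Z m r) : u =1 v -> face_fill u = face_fill v.
Proof. by move=> /funext ->. Qed.

Lemma face_fill_cs m r s (b : delta r s) (u : 'I_m.+2 -> Z m r) :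
  cs_map (Z m.+1) b (face_fill u) = face_fill (fun k => cs_map (Z m) b (u k)).
Proof.
rewrite raddf_sum; apply: eq_bigr => i _.
apply: etrans (esym (T_cs _ _ _)) _; congr (T _ _ _).
by apply: fill_natural => j x; rewrite V_cs.
Qed.

Lemma cofill_V p q m (a : delta p q) (y : 'I_m.+1 -> Z q m) :
  V m.+1 a (cofill y) = cofill (fun j => V m a (y j)).
Proof. by apply: (cofill_natural (f := fun r => V r a)) => r s b x; exact: V_cs. Qed.

Lemma matching_faces m r (z : Z m.+1 r) : matching (fun k => V r (coface k) z).
Proof. by move=> i j c g cg; rewrite -!V_comp cg. Qed.

Lemma comatching_codegen p m (z : Z p m.+1) :
  comatching (fun j => cs_map (Z p) (delta_codegen j) z).
Proof. by move=> i j c g cg; rewrite -!cs_map_comp cg. Qed.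

Definition faces m r (z : Z m.+1 r) k := V r (coface k) z.
Definition codegens p m (z : Z p m.+1) j := cs_map (Z p) (delta_codegen j) z.

(** The first summand carries the prescribed faces. The second is a filler of the prescribed
    codegeneracies, stripped of its own faces so as not to spoil them. *)
Definition extend m (x : Z m m) : Z m.+1 m.+1 :=
  let g := cofill (fun j => V m (delta_codegen j) x) in
  face_fill (fun i => cs_map (Z m) (coface i) x) + (g - face_fill (faces g)).

(** A projector onto the elements killed by all faces and all codegeneracies. Faces are removed
    first; removing codegeneracies afterwards creates no new faces because [cofill] commutes with
    [V]. *)
Definition project m (z : Z m.+1 m.+1) : Z m.+1 m.+1 :=
  let w := z - face_fill (faces z) in w - cofill (codegens w).

Lemma extend_linear m c (x y : Z m m) : extend (c *: x + y) = c *: extend x + extend y.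
Proof.
rewrite /extend (eq_cofill (fun j => linearP (V m (delta_codegen j)) c x y)) cofill_linear.
rewrite (eq_face_fill (fun i => linearP (cs_map (Z m) (coface i)) c x y)) face_fill_linear.
rewrite [X in _ - X](eq_face_fill (fun i => linearP (V m.+1 (coface i)) c _ _)) face_fill_linear.
by rewrite sub_lincomb addrACA -scalerDr.
Qed.

Lemma project_linear m c (x y : Z m.+1 m.+1) :
  project (c *: x + y) = c *: project x + project y.
Proof.
rewrite /project (eq_face_fill (fun i => linearP (V m.+1 (coface i)) c _ _)) face_fill_linear.
rewrite sub_lincomb.
rewrite (eq_cofill (fun j => linearP (cs_map (Z m.+1) (delta_codegen j)) c _ _)) cofill_linear.
by rewrite sub_lincomb.
Qed.

Lemma project_face m k (z : Z m.+1 m.+1) : V m.+1 (coface k) (project z) = 0.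
Proof.
rewrite /project; set w := z - _.
have w0 i : V m.+1 (coface i) w = 0.
  by rewrite linearB face_fillP ?subrr //; exact: matching_faces.
rewrite linearB w0 cofill_V (eq_cofill (y' := fun=> 0)) ?cofill0 ?subrr // => j.
by rewrite V_cs w0 raddf0.
Qed.

Lemma project_codegen m k (z : Z m.+1 m.+1) :
  cs_map (Z m.+1) (delta_codegen k) (project z) = 0.
Proof. by rewrite linearB cofillP ?subrr //; exact: comatching_codegen. Qed.

Lemma project_id m (z : Z m.+1 m.+1) : (forall k, V m.+1 (coface k) z = 0) ->
  (forall k, cs_map (Z m.+1) (delta_codegen k) z = 0) -> project z = z.
Proof.
move=> Vz cz; rewrite /project (eq_face_fill (v := fun=> 0)) // face_fill0 subr0.
by rewrite (eq_cofill (y' := fun=> 0)) // cofill0 subr0.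
Qed.

Section Extend.
Variables (m : nat) (x : Z m m).
Hypothesis endo_x : forall c : delta m m, V m c x = cs_map (Z m) c x.

Lemma extend_face k : V m.+1 (coface k) (extend x) = cs_map (Z m) (coface k) x.
Proof.
rewrite linearD linearB !face_fillP.
- by rewrite subrr addr0.
- exact: matching_faces.
by move=> i j c g cg; rewrite !V_cs !endo_x -!cs_map_comp cg.
Qed.

(** The codegeneracies of the two boundary fillers cancel: a codegeneracy of a face of the cofiller
    is a face of a degeneracy of [x], that is, an endomap of [[m]] applied to [x], and there the two
    actions agree by [endo_x]. *)
Lemma extend_codegen k :
  cs_map (Z m.+1) (delta_codegen k) (extend x) = V m (delta_codegen k) x.
Proof.
rewrite linearD linearB !face_fill_cs !cofillP; last first.
  by move=> i j c g cg; rewrite -!V_cs -!endo_x -!V_comp cg.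
rewrite (eq_face_fill (u := fun i => _ (V _ _ _))
  (v := fun i => cs_map (Z m) (delta_codegen k) (cs_map (Z m) (coface i) x))).
  by rewrite addrC subrK.
move=> i; rewrite /faces -V_cs cofillP.
  by rewrite -V_comp endo_x cs_map_comp.
by move=> i' j c g cg; rewrite -!V_cs -!endo_x -!V_comp cg.
Qed.
End Extend.

Definition compatible_family (x : forall p, Z p p) : Prop :=
  forall p q (a : delta p q), V q a (x q) = cs_map (Z p) a (x p).

Definition generator_compatible (x : forall p, Z p p) m : Prop :=
  (forall i, V m.+1 (coface i) (x m.+1) = cs_map (Z m) (coface i) (x m)) /\
  (forall j, V m (delta_codegen j) (x m) = cs_map (Z m.+1) (delta_codegen j) (x m.+1)).

Lemma generator_compatibleP (x : forall p, Z p p) N :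
  (forall m, (m < N)%N -> generator_compatible x m) ->
  forall p q (a : delta p q), (p <= N)%N -> (q <= N)%N ->
    V q a (x q) = cs_map (Z p) a (x p).
Proof.
move=> gx; apply: delta_generated => [p|p q r b a bx ax|m i /gx[]//|m j /gx[]//].
  by rewrite V_id cs_map_id.
by rewrite V_comp bx V_cs ax -cs_map_comp.
Qed.

(** Turns an arbitrary family into a compatible one. Degree 0 is kept as it is, since [[0]] has no
    endomap but the identity. *)
Fixpoint assemble (z : forall p, Z p p) (p : nat) : Z p p :=
  match p with
  | 0 => z 0
  | m.+1 => project (z m.+1) + extend (assemble z m)
  end.

Definition disassemble (x : forall p, Z p p) (p : nat) : Z p p :=
  match p with
  | 0 => x 0
  | m.+1 => x m.+1 - extend (x m)
  end.

Lemma assemble_linear c z z' p :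
  assemble (fun p => c *: z p + z' p) p = c *: assemble z p + assemble z' p.
Proof.
elim: p => //= m ->; rewrite project_linear extend_linear.
by rewrite addrACA -scalerDr.
Qed.

Lemma disassemble_linear c z z' p :
  disassemble (fun p => c *: z p + z' p) p = c *: disassemble z p + disassemble z' p.
Proof. by case: p => //= m; rewrite extend_linear sub_lincomb. Qed.

(** Strong induction: extending from [m] to [m + 1] needs agreement for the endomaps of [[m]], and
    these are generated by cofaces and codegeneracies between objects up to [m]. *)
Lemma assemble_compatible z : compatible_family (assemble z).
Proof.
have gz m : generator_compatible (assemble z) m.
  elim/ltn_ind: m => m IHm.
  have endo c := generator_compatibleP IHm c (leqnn m) (leqnn m).
  split=> i; rewrite /= linearD.
    by rewrite project_face add0r extend_face.
  by rewrite project_codegen add0r extend_codegen.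
move=> p q a; apply: (@generator_compatibleP _ (maxn p q)) => // [|];
  by rewrite leq_max leqnn ?orbT.
Qed.

Lemma disassemble_face x m k : compatible_family x ->
  V m.+1 (coface k) (disassemble x m.+1) = 0.
Proof. by move=> cx; rewrite linearB extend_face ?cx ?subrr. Qed.

Lemma disassemble_codegen x m k : compatible_family x ->
  cs_map (Z m.+1) (delta_codegen k) (disassemble x m.+1) = 0.
Proof. by move=> cx; rewrite linearB extend_codegen -?cx ?subrr. Qed.

(** A compatible [x] differs from the extension of its previous component by an element without
    faces and codegeneracies, which [project] fixes. So compatible families are a retract of all
    families. *)
Lemma disassembleK x p : compatible_family x -> assemble (disassemble x) p = x p.
Proof.
move=> cx; elim: p => //= m ->; rewrite project_id ?subrK // => k.
  exact: (disassemble_face k cx).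
exact: (disassemble_codegen k cx).
Qed.
End Bisimplicial.

(** * The Thom-Sullivan functor *)

Section TensorMapTheory.
Variables (R : pzRingType) (S : comPzRingType) (phi : {rmorphism R -> S}).

Lemma tensor_map_comp (M M' M'' : lmodType R) (N N' N'' : lmodType S)
    (f : {linear M -> M'}) (f' : {linear M' -> M''}) (f'' : {linear M -> M''})
    (g : {linear N -> N'}) (g' : {linear N' -> N''}) (g'' : {linear N -> N''}) :
  (forall m, f'' m = f' (f m)) -> (forall v, g'' v = g' (g v)) ->
  forall x, tensor_map phi f'' g'' x = tensor_map phi f' g' (tensor_map phi f g x).
Proof.
move=> fE gE; apply: (tens_ext (g := tensor_map phi f' g' \o tensor_map phi f g)).
- exact: tensor_map_is_zmod_morphism.
- by move=> x y /=; rewrite !raddfB.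
by move=> m v /=; rewrite !tensor_mapE fE gE.
Qed.

Lemma tensor_map_id (M : lmodType R) (N : lmodType S)
    (f : {linear M -> M}) (g : {linear N -> N}) :
  f =1 id -> g =1 id -> forall x, tensor_map phi f g x = x.
Proof.
move=> fE gE; apply: (tens_ext (g := id)) => // [|m v].
  exact: tensor_map_is_zmod_morphism.
by rewrite tensor_mapE fE gE.
Qed.

Lemma tens_is_linear (M : lmodType R) (N : lmodType S) (m : M) :
  linear (fun v : N => tens phi m v).
Proof. by move=> c v v'; rewrite tensDr scale_tens. Qed.

End TensorMapTheory.

Section FormTensor.
Variables (k : fieldType) (A : comPzRingType) (phi : {rmorphism k -> A}).
Variables (n : nat) (X : cosimplicial A).
Local Notation Omega p := (Defs.form k n p).

Section Cosimplicial.
Variable p : nat.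

Definition form_tensor_obj r : lmodType A := tensor phi (Omega p) (X r).

Definition form_tensor_map r s (b : delta r s) :
    {linear form_tensor_obj r -> form_tensor_obj s} :=
  tensor_map phi (idfun : {linear Omega p -> Omega p}) (cs_map X b).

Fact form_tensor_map_id r x : form_tensor_map (delta_id r) x = x.
Proof. by apply: tensor_map_id => // v; exact: cs_map_id. Qed.

Fact form_tensor_map_comp r s t (b : delta s t) (a : delta r s) x :
  form_tensor_map (delta_comp b a) x = form_tensor_map b (form_tensor_map a x).
Proof. by apply: tensor_map_comp => // v; exact: cs_map_comp. Qed.

Definition form_tensor : cosimplicial A :=
  Cosimplicial form_tensor_map_id form_tensor_map_comp.
End Cosimplicial.

Definition form_tensor_pullback p q r (a : delta p q) :
    {linear form_tensor q r -> form_tensor p r} :=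
  tensor_map phi (form_pullback a : {linear Omega q -> Omega p})
    (idfun : {linear X r -> X r}).

Definition form_tensor_t p r (i : 'I_p.+1) : {linear form_tensor p r -> form_tensor p r} :=
  tensor_map phi (form_t i : {linear Omega p -> Omega p}) (idfun : {linear X r -> X r}).

Lemma form_tensor_pullback_id p r (z : form_tensor p r) :
  form_tensor_pullback r (delta_id p) z = z.
Proof. by apply: tensor_map_id => // v; exact: form_pullback_id. Qed.

Lemma form_tensor_pullback_comp p q s r (b : delta q s) (a : delta p q)
    (z : form_tensor s r) :
  form_tensor_pullback r (delta_comp b a) z =
  form_tensor_pullback r a (form_tensor_pullback r b z).
Proof. by apply: tensor_map_comp => // v; exact: form_pullback_comp. Qed.

Lemma form_tensor_pullback_cs p q r s (a : delta p q) (b : delta r s)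
    (z : form_tensor q r) :
  form_tensor_pullback s a (cs_map (form_tensor q) b z) =
  cs_map (form_tensor p) b (form_tensor_pullback r a z).
Proof.
transitivity (tensor_map phi (form_pullback a : {linear Omega q -> Omega p}) (cs_map X b) z);
  [symmetry|]; exact: tensor_map_comp.
Qed.

Lemma form_tensor_t_cs p r s (i : 'I_p.+1) (b : delta r s) (z : form_tensor p r) :
  form_tensor_t s i (cs_map (form_tensor p) b z) =
  cs_map (form_tensor p) b (form_tensor_t r i z).
Proof.
transitivity (tensor_map phi (form_t i : {linear Omega p -> Omega p}) (cs_map X b) z);
  [symmetry|]; exact: tensor_map_comp.
Qed.

Lemma form_tensor_t_sum p r (z : form_tensor p r) : \sum_i form_tensor_t r i z = z.
Proof.
apply: (tens_ext (f := fun z => \sum_i form_tensor_t r i z) (g := id)) => // [x y|v m].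
  by rewrite -sumrB; apply: eq_bigr => i _; exact: raddfB.
under eq_bigr do rewrite [form_tensor_t _ _ _]tensor_mapE.
by rewrite -tens_suml sum_form_t.
Qed.

Lemma form_tensor_pullback_t p q r (a : delta p q) i (z : form_tensor q r) :
  form_tensor_pullback r a (form_tensor_t r i z) =
  \sum_(j < p.+1 | a j == i) form_tensor_t r j (form_tensor_pullback r a z).
Proof.
apply: (tens_ext (f := fun z => form_tensor_pullback r a (form_tensor_t r i z))
  (g := fun z => \sum_(j < p.+1 | a j == i) form_tensor_t r j (form_tensor_pullback r a z)))
  => [x y|x y|v m].
- by rewrite !raddfB.
- by rewrite -sumrB; apply: eq_bigr => j _; rewrite !raddfB.
rewrite [form_tensor_t _ _ _]tensor_mapE [form_tensor_pullback _ _ _]tensor_mapE.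
under [RHS]eq_bigr do
  rewrite [form_tensor_pullback _ _ _]tensor_mapE [form_tensor_t _ _ _]tensor_mapE.
by rewrite -tens_suml; congr tens; exact: form_pullback_t.
Qed.

Lemma cofill_codegens_eq0 (Y : cosimplicial A) m (z : Y m.+1) :
  (forall y : Y m.+1, (forall j, cs_map Y (delta_codegen j) y = 0) -> y = 0) ->
  cofill (fun j => cs_map Y (delta_codegen j) z) = z.
Proof.
move=> Y0; apply/esym/eqP; rewrite -subr_eq0; apply/eqP/Y0 => j.
by rewrite linearB cofillP ?subrr //; exact: comatching_codegen.
Qed.

(** If [X] has no nonzero normalized elements in this degree, [cofill] recovers each element of [X]
    from its codegeneracies. The formula is linear and natural, so it holds on pure tensors and
    hence on the whole tensor product. *)
Lemma form_tensor_normalized_eq0 p m (z : form_tensor p m.+1) :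
  (forall x : X m.+1, normalized x -> x = 0) ->
  (forall j, cs_map (form_tensor p) (delta_codegen j) z = 0) -> z = 0.
Proof.
move=> X0 z0.
have cofillE : cofill (fun j => cs_map (form_tensor p) (delta_codegen j) z) = z.
  apply: (tens_ext (f := fun z => cofill (fun j => cs_map (form_tensor p) (delta_codegen j) z))
    (g := id)) => // [x y|v x].
    transitivity (cofill (fun j => -1 *: cs_map (form_tensor p) (delta_codegen j) y +
        cs_map (form_tensor p) (delta_codegen j) x)).
      by apply: eq_cofill => j; rewrite scaleN1r [LHS]raddfB; exact: addrC.
    by rewrite cofill_linear scaleN1r; exact: addrC.
  pose tens_v r : {linear X r -> form_tensor p r} := HB.pack (fun x : X r => tens phi v x)
    (GRing.isLinear.Build _ _ _ _ _ (@tens_is_linear _ _ phi _ (X r) v)).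
  rewrite -[in RHS](cofill_codegens_eq0 (Y := X) x X0).
  rewrite [RHS](cofill_natural (f := tens_v)) => [|r s b y].
    by apply: eq_cofill => j; exact: tensor_mapE.
  by symmetry; exact: tensor_mapE.
by rewrite -cofillE (eq_cofill (y' := fun=> 0)) ?cofill0.
Qed.
End FormTensor.

Lemma family_linear_sum (A : pzRingType) (Z : nat -> lmodType A)
    (F : (forall p, Z p) -> forall p, Z p) (I : Type) (s : seq I) (c : I -> A)
    (x : I -> forall p, Z p) p :
  (forall c x y p, F (fun p => c *: x p + y p) p = c *: F x p + F y p) ->
  F (fun p => \sum_(i <- s) c i *: x i p) p = \sum_(i <- s) c i *: F (x i) p.
Proof.
move=> FP; elim: s => [|i s IHs].
  (* The zero family is rewritten as a linear combination, so that linearity yields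
     [F 0 = - F 0 + F 0]. *)
  rewrite big_nil (_ : (fun p => _) = (fun p => (-1) *: (0 : Z p) + 0)).
    by rewrite FP scaleN1r addNr.
  by apply: functional_extensionality_dep => q; rewrite big_nil scaler0 addr0.
rewrite big_cons -IHs -FP; congr (F _ p).
by apply: functional_extensionality_dep => q; rewrite big_cons.
Qed.

(** * Trivializations common to all degrees *)

Section Span.
Variables (A : pzRingType) (M : lmodType A).

Definition in_span r s (b : 'M[A]_(r, s)) (x : 'I_r -> M) : Prop :=
  exists y : 'I_s -> M, forall i, x i = \sum_j b i j *: y j.

Lemma in_span0 r s (b : 'M[A]_(r, s)) : in_span b (fun=> 0).
Proof. by exists (fun=> 0) => i; rewrite big1 // => j _; rewrite scaler0. Qed.

Lemma in_span_mul r s t (b : 'M[A]_(r, s)) (e : 'M[A]_(s, t)) x :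
  in_span (b *m e) x -> in_span b x.
Proof.
move=> [y xE]; exists (fun l => \sum_j e l j *: y j) => i.
by rewrite xE mulmx_act.
Qed.
End Span.

Section UniformResolution.
Variables (A : comPzRingType) (Z : nat -> lmodType A) (q r : nat) (a : 'M[A]_(q, r)).
Variable z : forall p, 'I_r -> Z p.
Hypothesis res_z : forall p, resolved a (z p).

Lemma noetherian_uniform : noetherian A ->
  exists s (b : 'M[A]_(r, s)), a *m b = 0 /\ forall p, in_span b (z p).
Proof.
move=> /(noetherian_syzygies a)[s [b [ab bE]]]; exists s, b; split=> // p.
have [t [c [y [/bE[e ->] zE]]]] := res_z p.
by apply: (@in_span_mul _ _ _ _ _ _ e); exists y.
Qed.

(** The syzygy matrices of the finitely many degrees below [N] are placed side by side; from [N] on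
    the vectors are zero and lie in every span. *)
Lemma bounded_uniform N : (forall p i, (N <= p)%N -> z p i = 0) ->
  exists s (b : 'M[A]_(r, s)), a *m b = 0 /\ forall p, in_span b (z p).
Proof.
move=> z0; suff [s [b [ab bz]]] : exists s (b : 'M[A]_(r, s)),
    a *m b = 0 /\ forall p, (p < N)%N -> in_span b (z p).
  exists s, b; split=> // p; have [/bz//|Np] := ltnP p N.
  by rewrite (_ : z p = fun=> 0); [exact: in_span0 | apply/funext => i; exact: z0].
elim: N {z0} => [|N [s [b [ab bz]]]]; first by exists 0, 0; rewrite mulmx0.
have [t [c [y [ac zE]]]] := res_z N.
exists (s + t)%N, (row_mx b c); rewrite mul_mx_row ab ac row_mx0; split=> // p.
rewrite ltnS leq_eqVlt => /predU1P[->|/bz pz].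
  by apply: (@in_span_mul _ _ _ _ _ _ (col_mx 0 1%:M)); exists y => i;
    rewrite mul_row_col mulmx0 add0r mulmx1.
apply: (@in_span_mul _ _ _ _ _ _ (col_mx 1%:M 0)).
by rewrite mul_row_col mulmx0 addr0 mulmx1.
Qed.
End UniformResolution.

(** By linearity of [disassemble], a relation in the Thom-Sullivan module holds in each tensor
    product, where it is resolved. With one matrix for all degrees, [assemble] carries the
    resolution back. *)
Lemma thom_sullivan_eq_flat (k : fieldType) (A : comPzRingType) (phi : {rmorphism k -> A})
    (X : cosimplicial A) n :
  noetherian A \/ finite_dimensional X -> (forall i, flat (X i)) ->
  eq_flat (thom_sullivan phi n X).
Proof.
move=> AX flatX q r a x ax.
pose Z := form_tensor phi n X.
pose V := @form_tensor_pullback _ _ phi n X.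
pose T := @form_tensor_t _ _ phi n X.
have V_id : forall p r (z : Z p r), V p p r (delta_id p) z = z.
  exact: form_tensor_pullback_id.
have V_comp : forall p q s r (b : delta q s) (a : delta p q) (z : Z s r),
    V p s r (delta_comp b a) z = V p q r a (V q s r b z).
  exact: form_tensor_pullback_comp.
have V_cs : forall p q r s (a : delta p q) (b : delta r s) (z : Z q r),
    V p q s a (cs_map (Z q) b z) = cs_map (Z p) b (V p q r a z).
  exact: form_tensor_pullback_cs.
have T_sum : forall p r (z : Z p r), \sum_i T p r i z = z.
  exact: form_tensor_t_sum.
have V_T : forall p q r (a : delta p q) i (z : Z q r),
    V p q r a (T q r i z) = \sum_(j < p.+1 | a j == i) T p r j (V p q r a z).
  exact: form_tensor_pullback_t.
have T_cs : forall p r s (i : 'I_p.+1) (b : delta r s) (z : Z p r),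
    T p s i (cs_map (Z p) b z) = cs_map (Z p) b (T p r i z).
  exact: form_tensor_t_cs.
pose D := disassemble V T; pose S := assemble V T.
have cx j : compatible_family V (x j) := ts_compatible (x j).
have sumE (I : Type) (s : seq I) c (u : I -> thom_sullivan phi n X) p :
    (\sum_(i <- s) c i *: u i) p = \sum_(i <- s) c i *: u i p.
  by elim: s => [|i s IHs]; rewrite ?big_nil // !big_cons -IHs.
pose z p j : Z p p := D (x j) p.
have az p i : \sum_j a i j *: z p j = 0.
  rewrite -(family_linear_sum (F := D) _ (fun j => a i j) (fun j => x j)); last first.
    exact: disassemble_linear.
  rewrite (_ : (fun p => _) = (fun p => (-1) *: (0 : Z p p) + 0)).
    by rewrite [LHS]disassemble_linear scaleN1r addNr.
  apply: functional_extensionality_dep => m; rewrite scaler0 addr0.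
  by rewrite -[LHS]sumE ax.
have res_z p : resolved a (z p).
  have flat_p := @eq_flat_tensor _ _ phi (Defs.form k n p) _ (flat_eq_flat (flatX p)).
  exact: flat_p (az p).
have [s [b [ab bz]]] : exists s (b : 'M[A]_(r, s)),
    a *m b = 0 /\ forall p, in_span b (z p).
  case: AX => [noethA|[d Xd]]; first exact: (noetherian_uniform res_z noethA).
  (* The bound [d + 1] rather than [d] excludes degree 0, where [disassemble] imposes no
     vanishing. *)
  apply: (bounded_uniform (N := d.+1) res_z) => -[//|m] j dm.
  apply: form_tensor_normalized_eq0 => [y|i]; first exact: (Xd m.+1 (ltnW dm)).
  exact: disassemble_codegen.
pose y p := projT1 (cid (bz p)).
have yE p j : z p j = \sum_l b j l *: y p l := projT2 (cid (bz p)) j.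
(* The [y p l] are chosen separately for each [p] and need not be compatible; [assemble] makes them
   so. *)
pose u l := ThomSullivan (assemble_compatible V_id V_comp V_cs T_sum V_T T_cs (fun p => y p l)).
exists s, b, u; split=> // j; apply: thom_sullivanP => p.
rewrite sumE -[LHS](disassembleK V_id V_comp V_cs T_sum V_T T_cs p (cx j)).
rewrite -(family_linear_sum (F := S) _ (fun l => b j l) (fun l p => y p l)); last first.
  exact: assemble_linear.
apply: (congr1 (fun w => S w p)); apply: functional_extensionality_dep => m.
exact: yE.
Qed.

Theorem corollary6p14
  (k : fieldType) (char_k : [pchar k] =i pred0)
  (A : comPzRingType) (phi : {rmorphism k -> A})
  (X : cosimplicial A)
  (AX : noetherian A \/ finite_dimensional X)
  (flatX : forall i : nat, flat (X i)) :
  forall n : nat, flat (thom_sullivan phi n X).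
Proof. by move=> n; exact/eq_flat_flat/thom_sullivan_eq_flat. Qed.
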